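(* Let $n\ge2$ be an integer and let $g_{C,H}:\mathbb{R}\to\mathbb{R}$ be a positive solution of the equation $$(g')^2+g^{2-2n}+(H^2-1)g^2+2Hg^{2-n}=C$$ associated with a non-negative $H$ and a positive constant $C$. If $\mu,\lambda,r,\theta:\mathbb{R}\to\mathbb{R}$ are defined by $$r=\frac{g_{C,H}}{\sqrt{C}},\quad \lambda=H+g_{C,H}^{-n},\quad \mu=nH-(n-1)\lambda=H-(n-1)g_{C,H}^{-n},\quad \theta(u)=\int_0^u\frac{r(s)\lambda(s)}{1+r^2(s)}\,ds,$$ then the map $\phi:S^{n-1}\times\mathbb{R}\to H^{n+1}$ given by $$\phi(y,u)=\Big(r(u)\,y,\ \sqrt{1+r(u)^2}\,\sinh(\theta(u)),\ \sqrt{1+r(u)^2}\,\cosh(\theta(u))\Big)$$ defines an embedded hypersurface in $H^{n+1}$ with constant mean curvature $H$. Moreover, if $H^2>1$, the embedded manifold defined by $\phi$ admits the group $O(n)\times\mathbb{Z}$ in its group of isometries, where $\mathbb{Z}$ is the group of integers.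
   Context: The hyperbolic space is modelled as $H^{n+1}=\{x\in\mathbb{R}^{n+2}: x_1^2+\dots+x_{n+1}^2-x_{n+2}^2=-1\}$, with the product $\langle v,w\rangle=v_1w_1+\dots+v_{n+1}w_{n+1}-v_{n+2}w_{n+2}$ on $\mathbb{R}^{n+2}$. $S^{n-1}$ is the unit sphere of $\mathbb{R}^n$ and $O(n)$ is the group of $n\times n$ orthogonal matrices. The mean curvature is the average of the $n$ principal curvatures, i.e. of the eigenvalues of $A(v)=-\bar\nabla_v\nu$, with $\nu$ a unit normal field.
   Formalization: The positive solution g is taken to be twice differentiable, and a constant g must be a critical point of v^{2-2n}+(H^2-1)v^2+2Hv^{2-n}; for other constant solutions (e.g. H=0, g=c small) the mean curvature is not H. *)

(* Defs.v *)
From HB Require Import structures.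
From mathcomp Require Import all_boot all_order all_algebra.
From mathcomp Require Import all_classical all_reals all_analysis.

Set Implicit Arguments.
Unset Strict Implicit.
Unset Printing Implicit Defensive.

Import Order.TTheory GRing.Theory Num.Theory.
Import numFieldNormedType.Exports.

Local Open Scope classical_set_scope.
Local Open Scope ring_scope.

Definition sinh (R : realType) (x : R) : R := (expR x - expR (- x)) / 2.
Definition cosh (R : realType) (x : R) : R := (expR x + expR (- x)) / 2.

Definition oriented_integral (R : realType) (f : R -> R) (a b : R) : R :=
  if a <= b then \int[lebesgue_measure]_(s in `[a, b]) f s
  else - \int[lebesgue_measure]_(s in `[b, a]) f s.

(* [v ^ (2 - 2n) + (H^2 - 1) v^2 + 2 H v ^ (2 - n)], so that the equation for
   [g] reads [(g')^2 + potential n H g = C]. *)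
Definition potential (R : realType) (n : nat) (H v : R) : R :=
  v ^ (2 - 2 * n%:Z) + (H ^+ 2 - 1) * v ^+ 2 + 2 * H * v ^ (2 - n%:Z).

(* A solution is twice differentiable, and a constant solution has to be an
   equilibrium, i.e. a critical point of [potential n H].  The second clause
   concerns constant [g] only: when [potential n H c = C] but [c] is not a
   critical point, the constant [c] satisfies the first-order equation without
   being a solution of its differentiated form
   [g'' = - (potential n H)' (g) / 2], and the corresponding cylinder does not
   have mean curvature [H].  Likewise, without the second derivative one could
   insert such constant pieces at the turning points of a nonconstant [g]. *)
Definition positive_solution (R : realType) (n : nat) (C H : R) (g : R -> R) :
    Prop :=
  [/\ forall u, 0 < g u,
      forall u, derivable g u 1 /\ derivable (derive1 g) u 1,
      forall u, (derive1 g u) ^+ 2 + (g u) ^ (2 - 2 * n%:Z)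
                + (H ^+ 2 - 1) * (g u) ^+ 2 + 2 * H * (g u) ^ (2 - n%:Z) = C
    & forall c, (forall u, g u = c) -> derive1 (potential n H) c = 0].

Definition dot (R : realType) (m : nat) (v w : 'rV[R]_m) : R :=
  \sum_(i < m) v 0 i * w 0 i.

Definition minkowski (R : realType) (m : nat) (v w : 'rV[R]_(m + 1)) : R :=
  dot (lsubmx v) (lsubmx w) - dot (rsubmx v) (rsubmx w).

(* The space H^m in R^(m + 1). *)
Definition hyperboloid (R : realType) (m : nat) : set 'rV[R]_(m + 1) :=
  [set x | minkowski x x = -1].

Fixpoint Ck (R : realType) (V W : normedModType R) (k : nat) (f : V -> W) :
    Prop :=
  if k is k'.+1 then
    continuous f /\
    forall v, (forall x, derivable f x v) /\ Ck k' (fun x => 'D_v f x)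
  else continuous f.

Definition smooth (R : realType) (V W : normedModType R) (f : V -> W) : Prop :=
  forall k, Ck k f.

(* S^(n-1) x R, as a closed submanifold of R^n x R.  A smooth map on it is
   represented by a smooth map on R^n x R of which only the restriction is
   relevant; its differential at [p] is [X |-> 'D_X f p] on vectors tangent
   at [p], which depends on the restriction only. *)
Definition cylinder (R : realType) (n : nat) : set ('rV[R]_n * R) :=
  [set p | dot p.1 p.1 = 1].

Definition tangent (R : realType) (n : nat) (p X : 'rV[R]_n * R) : Prop :=
  dot p.1 X.1 = 0.

Definition embedded_hypersurface (R : realType) (n : nat)
    (phi : 'rV[R]_n * R -> 'rV[R]_(n + 1 + 1)) : Prop :=
  [/\ smooth phi,
      phi @` @cylinder R n `<=` @hyperboloid R (n + 1),
      forall p X, cylinder p -> tangent p X -> 'D_X phi p = 0 -> X = 0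
    & exists psi : 'rV[R]_(n + 1 + 1) -> 'rV[R]_n * R,
        (forall p, cylinder p -> psi (phi p) = p) /\
        {within phi @` @cylinder R n, continuous psi}].

Definition unit_normal_field (R : realType) (n : nat)
    (phi nu : 'rV[R]_n * R -> 'rV[R]_(n + 1 + 1)) : Prop :=
  smooth nu /\
  forall p, cylinder p ->
    [/\ minkowski (nu p) (phi p) = 0,
        forall X, tangent p X -> minkowski (nu p) ('D_X phi p) = 0
      & minkowski (nu p) (nu p) = 1].

(* The Levi-Civita derivative in the hyperbolic space of the field [nu] along
   [phi]: the derivative in the flat space, projected to the tangent space of
   the hyperboloid at [x = phi p] (orthogonally, with [<x, x> = -1]). *)
Definition hyp_derive (R : realType) (n : nat)
    (phi nu : 'rV[R]_n * R -> 'rV[R]_(n + 1 + 1)) (p X : 'rV[R]_n * R) :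
    'rV[R]_(n + 1 + 1) :=
  'D_X nu p + minkowski ('D_X nu p) (phi p) *: phi p.

Definition shape_operator (R : realType) (n : nat)
    (phi nu : 'rV[R]_n * R -> 'rV[R]_(n + 1 + 1)) (p : 'rV[R]_n * R)
    (A : 'rV[R]_n * R -> 'rV[R]_n * R) : Prop :=
  forall X, tangent p X ->
    tangent p (A X) /\ 'D_(A X) phi p = - hyp_derive phi nu p X.

Definition tangent_basis (R : realType) (n : nat) (p : 'rV[R]_n * R)
    (e : 'I_n -> 'rV[R]_n * R) : Prop :=
  (forall i, tangent p (e i)) /\
  forall X, tangent p X ->
    exists! c : 'rV[R]_n, X = \sum_(i < n) c 0 i *: e i.

(* [k] lists the eigenvalues of the shape operator, with multiplicities. *)
Definition principal_curvatures (R : realType) (n : nat)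
    (phi nu : 'rV[R]_n * R -> 'rV[R]_(n + 1 + 1)) (p : 'rV[R]_n * R)
    (k : 'I_n -> R) : Prop :=
  exists (A : 'rV[R]_n * R -> 'rV[R]_n * R) (e : 'I_n -> 'rV[R]_n * R),
    [/\ shape_operator phi nu p A, tangent_basis p e
      & forall i, A (e i) = k i *: e i].

Definition mean_curvature_at (R : realType) (n : nat)
    (phi nu : 'rV[R]_n * R -> 'rV[R]_(n + 1 + 1)) (p : 'rV[R]_n * R) (h : R) :
    Prop :=
  exists k : 'I_n -> R,
    principal_curvatures phi nu p k /\ h = (\sum_(i < n) k i) / n%:R.

Definition has_constant_mean_curvature (R : realType) (n : nat)
    (phi : 'rV[R]_n * R -> 'rV[R]_(n + 1 + 1)) (h : R) : Prop :=
  exists nu, unit_normal_field phi nu /\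
    forall p, cylinder p -> mean_curvature_at phi nu p h.

(* Isometries of the cylinder with the metric induced by [phi], that is, of
   the embedded manifold parametrized by [phi]. *)
Definition isometry (R : realType) (n : nat)
    (phi : 'rV[R]_n * R -> 'rV[R]_(n + 1 + 1))
    (F : 'rV[R]_n * R -> 'rV[R]_n * R) : Prop :=
  [/\ smooth F,
      forall p, cylinder p -> cylinder (F p),
      exists G : 'rV[R]_n * R -> 'rV[R]_n * R,
        smooth G /\
        forall p, cylinder p -> [/\ cylinder (G p), G (F p) = p & F (G p) = p]
    & forall p X Y, cylinder p -> tangent p X -> tangent p Y ->
        minkowski ('D_('D_X F p) phi (F p)) ('D_('D_Y F p) phi (F p))
        = minkowski ('D_X phi p) ('D_Y phi p)].

Definition orthogonal_mx (R : realType) (n : nat) (A : 'M[R]_n) : Prop :=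
  A *m A^T = 1%:M.

(* An injective group morphism from O(n) x Z to the group of isometries, maps
   being compared on the cylinder only. *)
Definition admits_O_x_Z (R : realType) (n : nat)
    (phi : 'rV[R]_n * R -> 'rV[R]_(n + 1 + 1)) : Prop :=
  exists rho : 'M[R]_n -> int -> 'rV[R]_n * R -> 'rV[R]_n * R,
    [/\ forall A k, orthogonal_mx A -> isometry phi (rho A k),
        forall A B k l, orthogonal_mx A -> orthogonal_mx B ->
          forall p, cylinder p -> rho (A *m B) (k + l) p = rho A k (rho B l p)
      & forall A B k l, orthogonal_mx A -> orthogonal_mx B ->
          (forall p, cylinder p -> rho A k p = rho B l p) -> A = B /\ k = l].

(* Main.v *)
Require Import Defs.
From HB Require Import structures.
From mathcomp Require Import all_boot all_order all_algebra.
From mathcomp Require Import all_classical all_reals all_analysis.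
From mathcomp Require Import ring lra zify.

(* Put F v := - (H^2 - 1) v + (n - 2) H v^(1 - n) + (n - 1) v^(1 - 2n), which is
   minus half the derivative of the potential.  Differentiating the equation for
   g gives g' (g'' - F(g)) = 0.  The function h := g'' - F(g) is a derivative,
   and wherever it does not vanish g' = g'' = 0, so that g is a root of a fixed
   nonzero polynomial and h = - F(g).  Hence h takes finitely many values, and
   by Darboux's theorem it is either identically zero or nowhere zero; in the
   latter case g is a constant, which is excluded because a constant solution is
   an equilibrium.  So g'' = F(g).

   In terms of r this says r'^2 + (r lambda)^2 = 1 + r^2, r'' = r - mu r lambda
   and (r lambda)' = mu r'.  With w = (1 + r^2)^(-1/2), N = (0, sinh, cosh)(theta)
   and B = (0, cosh, sinh)(theta), the field
     nu = - r lambda (y, 0, 0) - r^2 lambda w N + r' w B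
   is a unit normal whose derivative is - lambda d(phi) on the spheres and
   - mu d(phi) along the profile curve.  The map phi is inverted through theta,
   which is strictly increasing.

   The metric induced on the cylinder is r^2 <Y1, Y2> + t1 t2, so a period of g
   and an orthogonal matrix act by isometries.  If H > 1, then g takes its values
   in a compact subset of (0, +oo), where F is nonincreasing and Lipschitz.  By
   monotonicity of F a bounded solution has critical points beyond any u0; by
   uniqueness g is symmetric about each of them, and two reflections compose to
   a translation. *)

Import Order.TTheory GRing.Theory Num.Theory.
Import numFieldNormedType.Exports.

Local Open Scope classical_set_scope.
Local Open Scope ring_scope.

Set Implicit Arguments.
Unset Strict Implicit.

(** * Calculus on the real line *)

Section FTC.
Context {R : realType}.
Implicit Types (f : R -> R) (a b c u : R).

Lemma continuous_integrable f a b : continuous f ->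
  (@lebesgue_measure R).-integrable `[a, b] (EFin \o f).
Proof.
move=> cf; apply: continuous_compact_integrable; first exact: segment_compact.
exact: continuous_subspaceT.
Qed.

Lemma Rintegral_cat f a b c : continuous f -> a <= b -> b <= c ->
  \int[lebesgue_measure]_(s in `[a, c]) f s =
  \int[lebesgue_measure]_(s in `[a, b]) f s +
  \int[lebesgue_measure]_(s in `[b, c]) f s.
Proof.
move=> cf ab bc.
have /(_ b) := @Rintegral_itvB R f (BLeft a) (BRight c) _ (continuous_integrable _ _ cf).
rewrite !bnd_simp => /(_ ab bc).
rewrite Rintegral_itv_obnd_cbnd; first by move=> <-; rewrite addrC subrK.
apply: integrableS (continuous_integrable b c cf) => //.
by apply: subset_itvr; rewrite bnd_simp.
Qed.

(** With a base point below both [0] and [u], the two orientations are given by one formula, to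
    which the one-sided fundamental theorem applies. *)
Lemma oriented_integral_sub f a u : continuous f -> a <= 0 -> a <= u ->
  oriented_integral f 0 u =
  \int[lebesgue_measure]_(s in `[a, u]) f s -
  \int[lebesgue_measure]_(s in `[a, 0]) f s.
Proof.
move=> cf a0 au; rewrite /oriented_integral; case: ifPn => [u0|].
  by rewrite (@Rintegral_cat f a 0 u)// addrC addKr.
rewrite -ltNge => /ltW u0.
by rewrite (@Rintegral_cat f a u 0)// opprD addrA subrr add0r.
Qed.

Lemma is_derive_oriented_integral f u : continuous f ->
  is_derive u 1 (oriented_integral f 0) (f u).
Proof.
move=> cf; pose a := Num.min u 0 - 1.
have au : a < u by rewrite /a ltrBlDr; case: (leP u 0); lra.
have a0 : a < 0 by rewrite /a ltrBlDr; case: (leP u 0); lra.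
pose F x := \int[lebesgue_measure]_(s in `[a, x]) f s.
have uu1 : u < u + 1 by lra.
have [dF F'] : derivable F u 1 /\ derive1 F u = f u.
  exact: (continuous_FTC1_closed uu1 (continuous_integrable _ _ cf) au (cf u)).
have dF1 : is_derive u 1 F (f u) by apply: DeriveDef; [exact: dF | rewrite -derive1E].
apply: (@near_eq_is_derive _ _ _ (fun x => F x - F 0)).
  near=> x; rewrite (@oriented_integral_sub f a)// ltW//.
  by near: x; exact: lt_nbhsr.
by apply: is_derive_eq; rewrite subr0.
Unshelve. all: by end_near. Qed.

End FTC.

(** * Differentiation rules and Darboux's theorem *)

Section Calculus.
Context {R : realType}.
Implicit Types (f g : R -> R) (a b c u : R).

Lemma is_derive_continuous f u a : is_derive u 1 f a -> {for u, continuous f}.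
Proof.
by case=> df _; apply: differentiable_continuous; exact/derivable1_diffP.
Qed.

Lemma is_derive_derive1 f u : derivable f u 1 -> is_derive u 1 f (derive1 f u).
Proof. by move=> df; rewrite derive1E; exact: derivableP. Qed.

Lemma eq_is_derive f g u a b : f =1 g -> a = b ->
  is_derive u 1 f a -> is_derive u 1 g b.
Proof. by move=> /funext -> ->. Qed.

Lemma is_derive_add f g u a b : is_derive u 1 f a -> is_derive u 1 g b ->
  is_derive u 1 (fun x => f x + g x) (a + b).
Proof. by move=> fa gb; exact: is_deriveD. Qed.

Lemma is_derive_mul f g u a b : is_derive u 1 f a -> is_derive u 1 g b ->
  is_derive u 1 (fun x => f x * g x) (a * g u + f u * b).
Proof.
move=> fa gb; apply: (@is_derive_eq _ _ _ _ _ _ _ _ (is_deriveM fa gb)).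
by rewrite addrC /GRing.scale/= [a * _]mulrC.
Qed.

Lemma is_derive_scale k f u a : is_derive u 1 f a ->
  is_derive u 1 (fun x => k * f x) (k * a).
Proof. by move=> fa; exact: (is_deriveZ k). Qed.

Lemma is_derive_exp n f u a : is_derive u 1 f a ->
  is_derive u 1 (fun x => f x ^+ n) (n%:R * f u ^+ n.-1 * a).
Proof. move=> fa; have := is_deriveX n fa; congr is_derive.
by apply/funext => x; elim: n => [|n /= IH]; rewrite ?expr0// !exprS -IH. Qed.

Lemma is_derive_inv f u a : f u != 0 -> is_derive u 1 f a ->
  is_derive u 1 (fun x => (f x)^-1) (- a * (f u)^-1 ^+ 2).
Proof.
move=> fu0 fa; apply: (@is_derive_eq _ _ _ _ _ _ _ _ (is_deriveV fu0 fa)).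
by rewrite /GRing.scale/= mulrC mulrN mulNr exprVn.
Qed.

(** Serves for reflections ([k = -1]), for restrictions to lines and for exponential weights. *)
Lemma is_derive_affine f k c u a : is_derive (k * u + c) 1 f a ->
  is_derive u 1 (fun x => f (k * x + c)) (a * k).
Proof.
move=> fa; apply: (@is_derive1_comp _ f (fun x => k * x + c)) => //.
have := is_derive_add (is_derive_scale k (is_derive_id u 1)) (is_derive_cst c u 1).
by rewrite mulr1 addr0.
Qed.

(** The difference quotient tends to [a], so it is negative for all small positive increments. *)
Lemma is_derive_lt_right f u a b : is_derive u 1 f a -> a < 0 -> u < b ->
  exists2 z, u < z < b & f z < f u.
Proof.
move=> [df fa] a0 ub.
have q : t^-1 *: (f (t *: 1 + u) - f u) @[t --> (0 : R)^'+] --> a.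
  by rewrite -fa; apply: cvg_dnbhs_at_right.
have [t [tlt t0 tb]] : exists t, [/\ t^-1 *: (f (t *: 1 + u) - f u) < 0, 0 < t & t < b - u].
  near (0 : R)^'+ => t; exists t; split; near: t.
  - exact: (cvgr_lt _ q).
  - exact: nbhs_right_gt.
  - by apply: nbhs_right_lt; rewrite subr_gt0.
exists (t + u); first by rewrite ltrDr t0 -ltrBrDr.
move: tlt; rewrite [t *: 1]mulr1 /GRing.scale/= pmulr_rlt0 ?invr_gt0//.
by rewrite subr_lt0.
Unshelve. all: by end_near. Qed.

Lemma is_derive_gt_left f u a b : is_derive u 1 f a -> 0 < a -> b < u ->
  exists2 z, b < z < u & f z < f u.
Proof.
move=> df a0 bu.
have := @is_derive_affine f (-1) 0 (- u) a.
rewrite mulN1r opprK addr0 => /(_ df) /is_derive_lt_right/(_ _).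
rewrite mulrN1 oppr_lt0 => /(_ (- b) a0); rewrite ltrN2 => /(_ bu)[z /andP[uz zb]].
rewrite !mulN1r opprK !addr0 => fz; exists (- z) => //.
by rewrite ltrNr zb ltrNl.
Qed.

(** The function [f x - y x] has negative derivative at [a] and positive derivative at [b], so its
    minimum on [[a, b]] is interior and critical. *)
Lemma darboux_lt f (f' : R -> R) a b y : a < b ->
  (forall u, is_derive u 1 f (f' u)) -> f' a < y < f' b ->
  exists u, f' u = y.
Proof.
move=> ab df /andP[ya yb].
pose h x := f x + (- y) * x.
have dh u : is_derive u 1 h (f' u - y).
  have := is_derive_add (df u) (is_derive_scale (- y) (is_derive_id u 1)).
  by rewrite mulr1.
have ch : continuous h by move=> u; exact: is_derive_continuous (dh u).
have [c cab cmin] := EVT_min (ltW ab) (continuous_subspaceT ch).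
have cb : c < b.
  rewrite lt_neqAle (itvP cab) andbT; apply/eqP => cb.
  have [|z /andP[az zb]] := @is_derive_gt_left h b (f' b - y) a (dh b) _ ab.
    by rewrite subr_gt0.
  by rewrite ltNge -cb cmin// in_itv/= !ltW// cb.
have ac : a < c.
  rewrite lt_neqAle (itvP cab) andbT; apply/eqP => ac.
  have [|z /andP[az zb]] := @is_derive_lt_right h a (f' a - y) b (dh a) _ ab.
    by rewrite subr_lt0.
  by rewrite ltNge [in h a]ac cmin// in_itv/= !ltW.
exists c; apply/eqP; rewrite -subr_eq0; apply/eqP.
have c0 : is_derive c 1 h 0.
  apply: (@derive1_at_min _ h a b) (ltW ab) _ _ _.
  - by move=> t _; have [] := dh t.
  - by rewrite in_itv/= ac.
  - by move=> t tab; apply: cmin; apply: subset_itv_oo_cc.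
by have [_ <-] := dh c; have [_ <-] := c0.
Qed.

End Calculus.

(** * Second-order differential equations *)

Section Ode.
Context {R : realType}.
Implicit Types (f g h w d : R -> R) (a b c u z K M : R).

Lemma mean_value f (f' : R -> R) a b : (forall u, is_derive u 1 f (f' u)) ->
  a <= b -> exists2 c, a <= c <= b & f b - f a = f' c * (b - a).
Proof.
move=> df ab; have [|c] := @MVT_segment _ f f' a b ab (fun x _ => df x).
  by apply: continuous_subspaceT => x; exact: is_derive_continuous (df x).
by rewrite in_itv/= => cab e; exists c.
Qed.

(** When [b < a], the ordered case is applied to [- f (- x)], whose derivative at [u] is
    [f' (- u)]. *)
Lemma darboux f (f' : R -> R) a b y : (forall u, is_derive u 1 f (f' u)) ->
  f' a < y < f' b -> exists u, f' u = y.
Proof.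
move=> df yab; have [ab|ba|ab] := ltgtP a b; first exact: darboux_lt ab df yab.
  have dG u : is_derive u 1 (fun x => (-1) * f ((-1) * x + 0)) (f' (- u)).
    apply: (@is_derive_eq _ _ _ _ _ _ _ _
      (is_derive_scale (-1) (is_derive_affine (df ((-1) * u + 0))))).
    by rewrite !mulN1r mulrN1 opprK addr0.
  have [||u <-] := @darboux_lt _ _ (fun u => f' (- u)) (- a) (- b) y _ dG.
  - by rewrite ltrN2.
  - by rewrite !opprK.
  by exists (- u).
by move: yab; rewrite ab => /andP[y1 y2]; move: (lt_trans y1 y2); rewrite ltxx.
Qed.

(** If [f'] had both a zero and a nonzero value, Darboux would give it infinitely many nonzero
    values; each of them is determined by a root of [p], and there are finitely many roots. *)
Lemma derivative_zero_or_nonzero f (f' c phi : R -> R) (p : {poly R}) :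
  (forall u, is_derive u 1 f (f' u)) -> p != 0 ->
  (forall u, f' u = 0 \/ root p (c u) /\ f' u = phi (c u)) ->
  (forall u, f' u = 0) \/ (forall u, f' u != 0).
Proof.
move=> df p0 hf; apply/or_asboolP.
apply: contrapT => /negP; rewrite negb_or => /andP[].
move=> /asboolPn/existsNP[a /eqP fa0] /asboolPn/existsNP[b /negP/negPn/eqP fb0].
(* Dividing by [k + 2] keeps the value strictly between [0] and [f' a], as Darboux requires. *)
have val (k : nat) : exists u, f' u = f' a / k.+2%:R.
  have k2 : 1 < k.+2%:R :> R by rewrite ltr1n.
  have k0 : 0 < k.+2%:R :> R by rewrite ltr0n.
  have [fa|fa] : 0 < f' a \/ f' a < 0.
    by move: fa0; rewrite neq_lt => /orP[]; [right|left].
  - apply: (@darboux f f' b a) => //; rewrite fb0 divr_gt0//=.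
    by rewrite ltr_pdivrMr// ltr_pMr.
  - apply: (@darboux f f' a b) => //; rewrite fb0.
    rewrite ltr_pdivlMr// gtr_nMr// k2/=.
    by rewrite pmulr_llt0 ?invr_gt0.
have [U hU] := choice val.
(* These are [size p] distinct roots of [p], one more than its degree allows. *)
pose s := [seq c (U k) | k <- iota 0 (size p)].
have Us k : f' (U k) != 0 by rewrite hU mulf_neq0// invr_eq0 pnatr_eq0.
have Uroot k : root p (c (U k)) /\ f' (U k) = phi (c (U k)).
  by case: (hf (U k)) (Us k) => [->|//]; rewrite eqxx.
have: (size s < size p)%N; last by rewrite size_map size_iota ltnn.
apply: max_poly_roots => //.
  by apply/allP => _ /mapP[k _ ->]; have [] := Uroot k.
rewrite map_inj_uniq ?iota_uniq// => k l ckl.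
have : f' (U k) = f' (U l) by rewrite (Uroot k).2 (Uroot l).2 ckl.
rewrite !hU => /(mulfI fa0)/invr_inj/eqP.
by rewrite eqr_nat => /eqP[].
Qed.

(** Suppose [w' > 0] from [u0] on. If [w'' >= 0] there, [w] grows at least linearly and is
    unbounded. Otherwise [w''] is negative at some [u1]; since [w] increases, [w''] stays below that
    value, and [w'] must reach zero. *)
Lemma exists_critical_point w (w' w'' : R -> R) M u0 :
  (forall u, is_derive u 1 w (w' u)) -> (forall u, is_derive u 1 w' (w'' u)) ->
  (forall u v, w u <= w v -> w'' v <= w'' u) -> (forall u, `|w u| <= M) ->
  exists2 u, u0 <= u & w' u = 0.
Proof.
(* All the hypotheses are invariant under [w -> - w]. *)
wlog w0 : w w' w'' / 0 < w' u0 => [wlg|] dw dw' mono wM.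
  have [w0|w0|w0] := ltgtP 0 (w' u0); first exact: (wlg w w' w'').
    have [|||u u0u /eqP] := wlg _ _ _ _ (fun u => is_derive_scale (-1) (dw u))
      (fun u => is_derive_scale (-1) (dw' u)).
    - by rewrite mulN1r oppr_gt0.
    - by move=> u v; rewrite !mulN1r !lerN2; exact: mono.
    - by move=> u; rewrite mulN1r normrN.
    by rewrite mulN1r oppr_eq0 => /eqP; exists u.
  by exists u0.
apply: contrapT => nz.
have pos u : u0 <= u -> 0 < w' u.
  move=> u0u; rewrite ltNge; apply/negP => wu0; apply: nz.
  have [||c] := @IVT R w' u0 u 0 u0u.
  - by apply: continuous_subspaceT => x; exact: is_derive_continuous (dw' x).
  - by rewrite ge_min wu0 orbT le_max ltW.
  by rewrite in_itv/= => /andP[u0c _] wc; exists c.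
have M0 : 0 <= M by exact: le_trans (wM 0).
have [cvx|/existsNP[u1 /not_implyP[u01 /negP]]] :=
    pselect (forall u, u0 <= u -> 0 <= w'' u).
  (* At slope at least [w' u0], the increase of [w] up to this point is at least [2 M + 1], while
     [|w| <= M] allows [2 M]. *)
  pose u := u0 + (2 * M + 1) / w' u0.
  have u0u : u0 <= u by rewrite lerDl divr_ge0 ?ltW//; lra.
  have [c /andP[u0c cu] e] := mean_value dw u0u.
  have [e1 /andP[u0e _] e1E] := mean_value dw' u0c.
  have : w' u0 <= w' c by rewrite -subr_ge0 e1E mulr_ge0 ?subr_ge0 ?cvx.
  have uE : u - u0 = (2 * M + 1) / w' u0 by rewrite /u addrC addKr.
  have u0u' : 0 <= u - u0 by rewrite subr_ge0.
  move=> /(ler_wpM2r u0u') /=; rewrite -e uE mulrC divfK ?gt_eqF// => h.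
  have := ler_normB (w u) (w u0); have := ler_norm (w u - w u0).
  by have := wM u; have := wM u0; lra.
rewrite -ltNge => w1.
(* The zero of the tangent line to [w'] at [u1]; [w'] lies below that line to the right of [u1]. *)
pose u := u1 - w' u1 / w'' u1.
have u1u : u1 <= u.
  by rewrite lerDl oppr_ge0 pmulr_rle0 ?pos// invr_le0 ltW.
have [c /andP[u1c cu] e] := mean_value dw' u1u.
have wc : w'' c <= w'' u1.
  apply: mono; have [e1 /andP[ue _] e1E] := mean_value dw u1c.
  by rewrite -subr_ge0 e1E mulr_ge0 ?subr_ge0// ltW// pos// (le_trans u01).
have := pos u (le_trans u01 u1u).
rewrite ltNge => /negP; apply.
have uE : u - u1 = - (w' u1 / w'' u1) by rewrite /u addrC addKr.
have : (w'' c - w'' u1) * (u - u1) <= 0.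
  by rewrite mulr_le0_ge0 ?subr_le0 ?subr_ge0.
rewrite mulrBl -e uE mulrN opprK [w'' u1 * _]mulrC divfK ?lt_eqF//.
by rewrite subrK.
Qed.

(** A Gronwall argument: [E = d^2 + d'^2] satisfies [|E'| <= (1 + K) E], so [E exp(- L u)] is
    nonincreasing and [E exp(L u)] nondecreasing, with [L = 1 + K]. As [E z = 0], this gives
    [E <= 0] on both sides of [z]. *)
Lemma ode2_unique d (d' d'' : R -> R) K z :
  (forall u, is_derive u 1 d (d' u)) -> (forall u, is_derive u 1 d' (d'' u)) ->
  0 <= K -> (forall u, `|d'' u| <= K * `|d u|) -> d z = 0 -> d' z = 0 ->
  forall u, d u = 0.
Proof.
move=> dd dd' K0 dK dz d'z u.
pose E x := d x * d x + d' x * d' x.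
pose E' x := 2 * (d x * d' x + d' x * d'' x).
have dE (x : R) : is_derive x 1 E (E' x).
  apply: (@is_derive_eq _ _ _ _ _ _ _ _ (is_derive_add
    (is_derive_mul (dd x) (dd x)) (is_derive_mul (dd' x) (dd' x)))).
  by rewrite /E'; ring.
pose L := 1 + K.
have EL x : `|E' x| <= L * E x.
  rewrite /E' normrM ger0_norm//.
  have : `|d x * d' x + d' x * d'' x| <= `|d x| * `|d' x| + `|d' x| * (K * `|d x|).
    rewrite (le_trans (ler_normD _ _))// !normrM lerD2l ler_wpM2l//.
  have -> : E x = `|d x| ^+ 2 + `|d' x| ^+ 2.
    by rewrite !real_normK ?num_real.
  (* The estimate is [2 (1 + K) X Y <= (1 + K) (X^2 + Y^2)]. *)
  have := sqr_ge0 (`|d x| - `|d' x|); rewrite sqrrB /L.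
  move: `|d x| `|d' x| `|_ + _| => X Y Z XY ZXY.
  have : 0 <= (1 + K) * (X ^+ 2 - X * Y *+ 2 + Y ^+ 2) by apply: mulr_ge0 => //; exact: addr_ge0.
  by lra.
have dexp (k x : R) : is_derive x 1 (fun y => E y * expR (k * y + 0)) ((E' x + k * E x) * expR (k * x + 0)).
  apply: (@is_derive_eq _ _ _ _ _ _ _ _ (is_derive_mul (dE x)
    (is_derive_affine (is_derive_expR (k * x + 0))))).
  by ring.
have Ez : E z = 0 by rewrite /E dz d'z !mulr0 addr0.
suff : E u <= 0.
  rewrite /E -!expr2 => Eu; apply/eqP; rewrite -sqrf_eq0 eq_le sqr_ge0 andbT.
  by apply: le_trans Eu; rewrite lerDl sqr_ge0.
have [zu|/ltW uz] := leP z u.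
- have [c _] := mean_value (dexp (- L)) zu.
  rewrite Ez mul0r subr0 => e.
  have : E u * expR (- L * u + 0) <= 0.
    rewrite e mulr_le0_ge0 ?subr_ge0// mulr_le0_ge0 ?expR_ge0//.
    by rewrite mulNr subr_le0 (le_trans (ler_norm _)).
  by rewrite pmulr_lle0 ?expR_gt0.
- have [c _] := mean_value (dexp L) uz.
  rewrite Ez mul0r sub0r => e.
  have : 0 <= - (E u * expR (L * u + 0)).
    rewrite e mulr_ge0 ?subr_ge0// mulr_ge0 ?expR_ge0//.
    by have := EL c; rewrite ler_norml => /andP[+ _]; lra.
  by rewrite oppr_ge0 pmulr_lle0 ?expR_gt0.
Qed.

End Ode.

(** * Maps of class C^k on the cylinder *)

Section DirectionalDerivative.
Context {R : realType} {V W : normedModType R}.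
Implicit Types (f : V -> W) (x v : V).

(** A directional derivative and the derivative at [0] along the line have the same difference
    quotient; this brings in the one-variable rules. *)
Lemma is_derive_line f x v (l : W) :
  is_derive (0 : R) 1 (fun h : R => f (h *: v + x)) l -> is_derive x v f l.
Proof.
move=> [df fl]; apply: DeriveDef; first exact: (iffRL (derivable1P f x v) df).
rewrite -fl /derive; set g1 := fun h => h^-1 *: _; set g2 := fun h => h^-1 *: _.
suff -> : g1 = g2 by [].
by apply/funext => h; rewrite /g1 /g2 /= addr0 scale0r add0r [_ *: 1]mulr1.
Qed.

Lemma is_derive_affine_map f x v (l : W) :
  (forall h : R, f (h *: v + x) = f x + h *: l) -> is_derive x v f l.
Proof.
move=> fh; apply: is_derive_line; rewrite (_ : (fun _ => _) = cst (f x) + *:%R^~ l); last first.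
  by apply/funext => h; rewrite fh.
have d : is_derive (0 : R) 1 ( *:%R^~ l : R -> W) l.
  apply: DeriveDef; first exact/diff_derivable.
  by rewrite deriveE// diff_val scale1r.
have := is_deriveD (is_derive_cst (f x) (0 : R) 1) d.
by rewrite add0r.
Qed.

Lemma eq_Ck k f g : f =1 g -> Ck k f -> Ck k g.
Proof. by move=> /funext->. Qed.

Lemma Ck_cst k (w : W) : Ck k (fun _ : V => w).
Proof.
elim: k w => [|k IH] w /=; first exact: cst_continuous.
split; first exact: cst_continuous.
move=> v; split; first by move=> x; exact: derivable_cst.
by apply: (@eq_Ck _ (fun=> 0)) => // x; rewrite derive_cst.
Qed.

Lemma Ck_add k f g : Ck k f -> Ck k g -> Ck k (fun x => f x + g x).
Proof.
elim: k f g => [|k IH] f g /=.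
  by move=> cf cg x; apply: cvgD; [exact: cf | exact: cg].
move=> [cf df] [cg dg]; split; first by move=> x; apply: cvgD; [exact: cf | exact: cg].
move=> v; have [dfv Cf] := df v; have [dgv Cg] := dg v; split.
  by move=> x; exact: derivableD.
apply: (@eq_Ck _ (fun x => 'D_v f x + 'D_v g x)); last exact: IH.
by move=> x; apply/esym; exact: deriveD.
Qed.

Lemma Ck_scale k (c : R) f : Ck k f -> Ck k (fun x => c *: f x).
Proof.
elim: k f => [|k IH] f /=.
  by move=> cf x; apply: cvgZl_tmp; exact: cf.
move=> [cf df]; split.
  by move=> x; apply: cvgZl_tmp; exact: cf.
move=> v; have [dfv Cf] := df v; split.
  by move=> x; exact: derivableZ.
apply: (@eq_Ck _ (fun x => c *: 'D_v f x)); last exact: IH.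
by move=> x; apply/esym; exact: deriveZ.
Qed.

(** The derivative along [v] is the constant [l v], and constants are of class C^k for every k. *)
Lemma smooth_affine f (l : V -> W) : continuous f ->
  (forall x v (h : R), f (h *: v + x) = f x + h *: l v) -> smooth f.
Proof.
move=> cf fl [|k]//=; split=> // v.
have D x : is_derive x v f (l v) by apply: is_derive_affine_map => h; exact: fl.
split=> [x|]; first by have [] := D x.
apply: (@eq_Ck _ (fun=> l v)); last exact: Ck_cst.
by move=> x; have [_] := D x.
Qed.

End DirectionalDerivative.

Lemma is_derive_mx (R : realType) m n (M : R -> 'M[R]_(m, n)) (t : R) (N : 'M[R]_(m, n)) :
  (forall i j, is_derive t 1 (fun x => M x i j) (N i j)) -> is_derive t 1 M N.
Proof.
move=> dM; have D : derivable M t 1.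
  by apply/derivable_mxP => i j; have [] := dM i j.
apply: DeriveDef => //; rewrite derive_mx//; apply/matrixP => i j.
by rewrite mxE; have [_] := dM i j.
Qed.

Lemma linear_combination_continuous (R : realType) (V W : normedModType R)
    (I : Type) (s : seq I) (f : I -> V -> R) (w : I -> W) :
  (forall i, continuous (f i)) -> continuous (fun x => \sum_(i <- s) f i x *: w i).
Proof.
move=> cf; elim: s => [|j s IH].
  have -> : (fun x => \sum_(i <- [::]) f i x *: w i) = fun=> 0.
    by apply/funext => x; rewrite big_nil.
  exact: cst_continuous.
have -> : (fun x => \sum_(i <- j :: s) f i x *: w i) =
    fun x => f j x *: w j + \sum_(i <- s) f i x *: w i.
  by apply/funext => x; rewrite big_cons.
move=> x; apply: cvgD; last exact: IH.
by apply: cvgZr_tmp; exact: cf.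
Qed.

Lemma mulmxr_continuous (R : realType) n m (A : 'M[R]_(n, m)) :
  continuous (fun y : 'rV[R]_n => y *m A).
Proof.
have -> : (fun y : 'rV[R]_n => y *m A) =
    fun y : 'rV[R]_n => \sum_j y 0 j *: row j A.
  by apply/funext => y; rewrite mulmx_sum_row.
apply: (@linear_combination_continuous _ 'rV[R]_n 'rV[R]_m _ _
  (fun j (y : 'rV[R]_n) => y 0 j)) => j.
exact: coord_continuous.
Qed.

Lemma is_derive_scalel (R : realType) (W : normedModType R) (f : R -> R)
    (t a : R) (w : W) : is_derive t 1 f a ->
  is_derive t 1 (fun h => f h *: w) (a *: w).
Proof.
move=> [/derivable1_diffP df fa]; apply: DeriveDef.
  exact/diff_derivable/differentiableZl.
by rewrite deriveE ?diffZl// -?deriveE ?fa//; exact: differentiableZl.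
Qed.

(** * Maps of rotational type and their smoothness *)

Section Profile.
Context {R : realType} {n : nat}.
Implicit Types (y : 'rV[R]_n) (s t : R) (f a b c : R -> R) (p X : 'rV[R]_n * R).

Definition vec y (s t : R) : 'rV[R]_(n + 1 + 1) :=
  row_mx (row_mx y (const_mx s)) (const_mx t).

(** The common shape of the immersion and of its unit normal field, so that one derivative formula
    and one smoothness proof serve both. *)
Definition rot a b c p := vec (a p.2 *: p.1) (b p.2) (c p.2).

Lemma vecD y y' s s' t t' : vec (y + y') (s + s') (t + t') = vec y s t + vec y' s' t'.
Proof. by rewrite /vec !add_row_mx -!raddfD. Qed.

Lemma vecZ k y s t : vec (k *: y) (k * s) (k * t) = k *: vec y s t.
Proof. by rewrite /vec !scale_row_mx; congr (row_mx (row_mx _ _) _); apply/matrixP => i j; rewrite !mxE. Qed.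

Lemma vec_inj y y' s s' t t' : vec y s t = vec y' s' t' -> [/\ y = y', s = s' & t = t'].
Proof.
move=> /eq_row_mx[/eq_row_mx[-> /matrixP/(_ 0 0)]].
by rewrite !mxE => -> /matrixP/(_ 0 0); rewrite !mxE => ->.
Qed.

Lemma minkowski_vec y y' s s' t t' :
  Defs.minkowski (vec y s t) (vec y' s' t') = dot y y' + s * s' - t * t'.
Proof.
rewrite /Defs.minkowski /vec !row_mxKl !row_mxKr /dot; congr (_ - _).
  rewrite big_split_ord/= [X in _ + X]big_ord1 !row_mxEr !mxE; congr (_ + _).
  by apply: eq_bigr => i _; rewrite !row_mxEl.
by rewrite big_ord1 !mxE.
Qed.

Lemma is_derive_snd_line f p X (f' : R) : is_derive p.2 1 f f' ->
  is_derive (0 : R) 1 (fun h => f (h *: X + p).2) (X.2 * f').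
Proof.
move=> df; have := @is_derive_affine _ f X.2 p.2 0 f'.
rewrite mulr0 add0r [X.2 * f']mulrC => /(_ df); congr is_derive.
by apply/funext => h; rewrite [X.2 * h]mulrC.
Qed.

Lemma is_derive_rot a b c p X (a' b' c' : R) : is_derive p.2 1 a a' ->
  is_derive p.2 1 b b' -> is_derive p.2 1 c c' ->
  is_derive p X (rot a b c)
    (vec (X.2 * a' *: p.1 + a p.2 *: X.1) (X.2 * b') (X.2 * c')).
Proof.
move=> da db dc; apply: is_derive_line.
have aff f (f' : R) : is_derive p.2 1 f f' ->
    is_derive (0 : R) 1 (fun h => f (h *: X + p).2) (X.2 * f').
  exact: is_derive_snd_line.
apply: is_derive_mx => i j; rewrite (ord1 i) => {i}.
rewrite /rot/vec.
have [k ->|k ->] := split_ordP j; last first.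
  rewrite row_mxEr mxE; under eq_fun do rewrite row_mxEr mxE.
  exact: aff.
rewrite row_mxEl; under eq_fun do rewrite row_mxEl.
have [l ->|l ->] := split_ordP k; last first.
  rewrite row_mxEr mxE; under eq_fun do rewrite row_mxEr mxE.
  exact: aff.
rewrite row_mxEl; under eq_fun do rewrite row_mxEl mxE.
rewrite !mxE.
under eq_fun do rewrite /= !mxE.
have dl : is_derive (0 : R) 1 (fun h => h * X.1 0 l + p.1 0 l) (X.1 0 l).
  have := @is_derive_affine _ id (X.1 0 l) (p.1 0 l) 0 1 (is_derive_id _ _).
  by rewrite mul1r; congr is_derive; apply/funext => h; rewrite mulrC.
apply: (@is_derive_eq _ _ _ _ _ _ _ _ (is_derive_mul (aff _ _ da) dl)).
by rewrite mul0r scale0r !add0r.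
Qed.

(** A class of coefficient functions closed under differentiation: inductions on the order of
    differentiability never leave it. *)
Variable S : (R -> R) -> Prop.
Hypothesis S_derive : forall f, S f ->
  exists2 f', S f' & forall u : R, is_derive u 1 f (f' u).

Lemma S_continuous f : S f -> continuous f.
Proof. by move=> /S_derive[f' _ df] u; exact: is_derive_continuous (df u). Qed.

Lemma snd_continuous f (W : normedModType R) (w : W) : S f ->
  continuous (fun p : 'rV[R]_n * R => f p.2 *: w).
Proof.
move=> Sf p; apply: cvgZr_tmp; apply: (cvg_comp snd f); first exact: cvg_snd.
exact: S_continuous.
Qed.

Lemma Ck_snd k f (W : normedModType R) (w : W) : S f ->
  Ck k (fun p : 'rV[R]_n * R => f p.2 *: w).
Proof.
elim: k f w => [|k IH] f w Sf /=.
  exact: snd_continuous.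
split; first exact: snd_continuous.
move=> v; have [f' Sf' df] := S_derive Sf.
have D p : is_derive p v (fun p : 'rV[R]_n * R => f p.2 *: w) (f' p.2 *: (v.2 *: w)).
  apply: is_derive_line; rewrite scalerA [f' _ * _]mulrC.
  exact/is_derive_scalel/is_derive_snd_line.
split; first by move=> p; have [] := D p.
apply: (@eq_Ck _ _ _ _ (fun p => f' p.2 *: (v.2 *: w))); last exact: IH.
by move=> p; have [_] := D p.
Qed.

Lemma rot_continuous a b c : S a -> S b -> S c -> continuous (rot a b c).
Proof.
move=> Sa Sb Sc.
(* The matrix of the inclusion of the first [n] coordinates. *)
pose J : 'M[R]_(n, n + 1 + 1) := row_mx (row_mx 1%:M 0) 0.
have -> : rot a b c =
    fun p => a p.2 *: (p.1 *m J) + b p.2 *: vec 0 1 0 + c p.2 *: vec 0 0 1.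
  apply/funext => p.
  have -> : p.1 *m J = vec p.1 0 0.
    by rewrite /J /vec !mul_mx_row mulmx1 !mulmx0.
  by rewrite -!vecZ -!vecD !(mulr0, mulr1, scaler0, addr0, add0r).
move=> p; apply: cvgD; last exact: snd_continuous.
apply: cvgD; last exact: snd_continuous.
apply: cvgZ.
  by apply: (cvg_comp snd a); [exact: cvg_snd | exact: S_continuous].
apply: (cvg_comp fst (fun y : 'rV[R]_n => y *m J)); first exact: cvg_fst.
exact: mulmxr_continuous.
Qed.

(** The derivative along [v] is [v.2] times a map [rot a' b' c'], covered by induction, plus [a p.2]
    times a fixed vector, covered by [Ck_snd]. *)
Lemma Ck_rot k a b c : S a -> S b -> S c -> Ck k (rot a b c).
Proof.
elim: k a b c => [|k IH] a b c Sa Sb Sc /=; first exact: rot_continuous.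
split; first exact: rot_continuous.
move=> v; have [a' Sa' da] := S_derive Sa; have [b' Sb' db] := S_derive Sb.
have [c' Sc' dc] := S_derive Sc.
have D p := is_derive_rot v (da p.2) (db p.2) (dc p.2).
split; first by move=> p; have [] := D p.
apply: (@eq_Ck _ _ _ _ (fun p => v.2 *: rot a' b' c' p + a p.2 *: vec v.1 0 0)); last first.
  by apply: Ck_add; [apply/Ck_scale/IH | exact: Ck_snd].
move=> p; have [_ ->] := D p.
by rewrite -!vecZ !mulr0 -vecD !addr0 scalerA.
Qed.

End Profile.

(** * The equation for g *)

Section OneSided.
Context {R : realType}.
Implicit Types (f : R -> R) (a b u z : R).

(** A zero with nonzero derivative is isolated, because the difference quotient stays away from
    zero. *)
Lemma is_derive_neq0_right f u a : is_derive u 1 f a -> a != 0 -> f u = 0 ->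
  exists2 b, u < b & forall z, u < z < b -> f z != 0.
Proof.
move=> [df fa] a0 fu0.
have q : t^-1 *: (f (t *: 1 + u) - f u) @[t --> (0 : R)^'] --> a by rewrite -fa.
have [e /= e0 He] := cvgr_neq0 _ q a0.
exists (u + e); first by rewrite ltrDl.
move=> z /andP[uz zue]; apply/eqP => fz.
have zu0 : 0 < z - u by rewrite subr_gt0.
have := He (z - u); rewrite /= sub0r normrN gtr0_norm// ltrBlDl gt_eqF//.
by rewrite [_ *: 1]mulr1 subrK fz fu0 subrr scaler0 eqxx => /(_ zue isT).
Qed.

(** A derivative has no jump: if [f' u < 0], then [f] takes a smaller value just to the right of
    [u], although the mean value theorem makes it constant there. *)
Lemma derivative_eq0_right f (f' : R -> R) u b :
  (forall x : R, is_derive x 1 f (f' x)) -> u < b ->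
  (forall z, u < z < b -> f' z = 0) -> f' u = 0.
Proof.
wlog f'u : f f' / f' u < 0 => [wlg|] df ub f'0.
  have [fu|fu|//] := ltgtP (f' u) 0; first exact: (wlg f f').
  have fu' : -1 * f' u < 0 by rewrite mulN1r oppr_lt0.
  have := wlg _ _ fu' (fun x => is_derive_scale (-1) (df x)) ub.
  rewrite mulN1r => h; apply/eqP; rewrite -oppr_eq0 h// => z /f'0 ->.
  by rewrite mulr0.
have [z /andP[uz zb]] := is_derive_lt_right (df u) f'u ub.
have [|c] := MVT uz (fun x _ => df x).
  by apply: continuous_subspaceT => x; exact: is_derive_continuous (df x).
rewrite in_itv/= => /andP[uc cz] /eqP; rewrite f'0 ?uc ?(lt_trans cz)// mul0r subr_eq0.
by move=> /eqP ->; rewrite ltxx.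
Qed.

End OneSided.

Section Equation.
Context {R : realType} (m : nat) (C H : R).
Implicit Types (u v : R).

(* [- potential' / 2] *)
Definition force v : R :=
  - (H ^+ 2 - 1) * v + m%:R * H * v^-1 ^+ m.+1 + m.+1%:R * v^-1 ^+ (2 * m + 3).

(** With [n = m + 2] the exponents [2 - 2n] and [2 - n] are [-(2m + 2)] and [-m], so natural powers
    of the inverse suffice. *)
Lemma potentialE v :
  potential m.+2 H v = v^-1 ^+ (2 * m + 2) + (H ^+ 2 - 1) * v ^+ 2 + 2 * H * v^-1 ^+ m.
Proof.
rewrite /potential !exprVn; congr (_ + _ + _ * _).
  rewrite (_ : 2 - 2 * _ = - (2 * m + 2)%N%:Z) ?exprnN//.
  by lia.
by rewrite (_ : 2 - _ = - m%:Z) ?exprnN//; lia.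
Qed.

Lemma is_derive_potential v : 0 < v ->
  is_derive v 1 (potential m.+2 H) (- 2 * force v).
Proof.
move=> v0; rewrite (_ : potential m.+2 H = fun v => v^-1 ^+ (2 * m + 2) +
    (H ^+ 2 - 1) * v ^+ 2 + 2 * H * v^-1 ^+ m); last first.
  by apply/funext => x; exact: potentialE.
have dV := is_derive_inv (lt0r_neq0 v0) (is_derive_id v 1).
apply: (@is_derive_eq _ _ _ _ _ _ _ _ (is_derive_add (is_derive_add
  (is_derive_exp (2 * m + 2) dV) (is_derive_scale (H ^+ 2 - 1)
     (is_derive_exp 2 (is_derive_id v 1))))
  (is_derive_scale (2 * H) (is_derive_exp m dV)))).
rewrite /force /= expr1.
have -> : (2 * m + 2).-1 = (2 * m + 1)%N by lia.
(* For [m = 0] the predecessor is truncated, but both sides vanish. *)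
have -> : m%:R * v^-1 ^+ m.-1 * (-1 * v^-1 ^+ 2) = - m%:R * v^-1 ^+ m.+1.
  by case: m => [|k]; rewrite ?mul0r ?mulr0 ?oppr0 ?mul0r//= !exprS; ring.
have -> : v^-1 ^+ (2 * m + 3) = v^-1 ^+ (2 * m + 1) * v^-1 ^+ 2.
  by rewrite -exprD; congr (_ ^+ _); lia.
have -> : (2 * m + 2)%:R = 2 * m.+1%:R :> R by rewrite -natrM; congr _%:R; lia.
by ring.
Qed.

Variable g : R -> R.
Hypothesis hg : positive_solution m.+2 C H g.

Let g1 : R -> R := derive1 g.
Let g2 : R -> R := derive1 (derive1 g).

Lemma sol_gt0 u : 0 < g u.
Proof. by case: hg. Qed.

Lemma sol_derive u : is_derive u 1 g (g1 u).
Proof.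
by case: hg => _ /(_ u)[dg _] _ _; exact: is_derive_derive1.
Qed.

Lemma sol_derive2 u : is_derive u 1 g1 (g2 u).
Proof.
by case: hg => _ /(_ u)[_ dg] _ _; exact: is_derive_derive1.
Qed.

Lemma sol_energy u : g1 u ^+ 2 + potential m.+2 H (g u) = C.
Proof. by case: hg => _ _ /(_ u) <- _; rewrite /potential !addrA. Qed.

Lemma force_continuous : continuous (fun u => force (g u)).
Proof.
move=> u; have dV := is_derive_inv (lt0r_neq0 (sol_gt0 u)) (sol_derive u).
apply: (@is_derive_continuous _ _ _ _ (is_derive_add (is_derive_add
  (is_derive_scale _ (sol_derive u)) (is_derive_scale _ (is_derive_exp _ dV)))
  (is_derive_scale _ (is_derive_exp _ dV)))).
Qed.

Lemma sol_ode_weak u : g1 u * (g2 u - force (g u)) = 0.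
Proof.
have dP : is_derive u 1 (fun u => potential m.+2 H (g u)) (- 2 * force (g u) * g1 u).
  exact: is_derive1_comp (is_derive_potential (sol_gt0 u)) (sol_derive u).
have := is_derive_add (is_derive_exp 2 (sol_derive2 u)) dP.
rewrite (_ : (fun _ => _) = cst C); last by apply/funext => x; exact: sol_energy.
move=> [_]; rewrite derive_cst /= expr1 => e.
have : 2 * (g1 u * (g2 u - force (g u))) = 0.
  by rewrite e; ring.
by move=> /eqP; rewrite mulf_eq0 pnatr_eq0/= => /eqP.
Qed.

Lemma sol_ode u : g2 u = force (g u).
Proof.
(* A primitive of [h]: no continuity of [g2] is available, but [h] is a derivative, so Darboux's
   theorem applies to it. *)
pose K x := g1 x + -1 * oriented_integral (fun u => force (g u)) 0 x.
pose h x := g2 x - force (g x).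
have dK (x : R) : is_derive x 1 K (h x).
  apply: (@is_derive_eq _ _ _ _ _ _ _ _ (is_derive_add (sol_derive2 x)
    (is_derive_scale (-1) (is_derive_oriented_integral x force_continuous)))).
  by rewrite mulN1r.
(* The equation [potential v = C] multiplied by [v^(2m + 2)]; its constant term is 1. *)
pose p : {poly R} := 1%:P + (H ^+ 2 - 1) *: 'X^(2 * m + 4) + (2 * H) *: 'X^(m.+2)
   - C *: 'X^(2 * m + 2).
have p0 : p != 0.
  apply/eqP => /(congr1 (fun q => q.[0])); rewrite horner0.
  rewrite /p !(hornerD, hornerN, hornerZ, hornerXn, hornerC) !expr0n !addnS/=.
  by rewrite !mulr0 subr0 !addr0 => /eqP; rewrite oner_eq0.
have rootp x : g1 x = 0 -> root p (g x).
  move=> g1x; have := sol_energy x; rewrite g1x expr0n/= add0r potentialE => eC.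
  have gx := lt0r_neq0 (sol_gt0 x).
  rewrite rootE /p -eC !(hornerD, hornerN, hornerZ, hornerXn, hornerC).
  have xg k : (g x)^-1 ^+ k * g x ^+ k = 1 by rewrite -exprMn mulVf// expr1n.
  have -> : g x ^+ (2 * m + 4) = g x ^+ 2 * g x ^+ (2 * m + 2).
    by rewrite -exprD; congr (_ ^+ _); lia.
  have e1 := xg (2 * m + 2)%N.
  have e2 : (g x)^-1 ^+ m * g x ^+ (2 * m + 2) = g x ^+ m.+2.
    by rewrite (_ : 2 * m + 2 = m + m.+2)%N ?exprD ?mulrA ?xg ?mul1r//; lia.
  move: e1 e2; move: (g x ^+ (2 * m + 2)) (g x ^+ m.+2) => G G2 e1 e2.
  rewrite -e2; apply/eqP; transitivity (1 - (g x)^-1 ^+ (2 * m + 2) * G).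
    by ring.
  by rewrite e1 subrr.
have hx x : h x = 0 \/ root p (g x) /\ h x = - force (g x).
  have [->|hx0] := eqVneq (h x) 0; [by left | right].
  have /eqP := sol_ode_weak x; rewrite mulf_eq0 (negPf hx0) orbF => /eqP g1x.
  split; first exact: rootp.
  (* If [g2 x] were nonzero, [g1] would have no zero just to the right of [x]; there [h] would
     vanish by [sol_ode_weak], hence also at [x]. *)
  have [g20|g20] := eqVneq (g2 x) 0; first by rewrite /h g20 sub0r.
  have [b xb g1n] := is_derive_neq0_right (sol_derive2 x) g20 g1x.
  move: hx0; rewrite (derivative_eq0_right dK xb) ?eqxx// => z /g1n g1z.
  by have /eqP := sol_ode_weak z; rewrite mulf_eq0 (negPf g1z) => /eqP.
have [h0|hn0] := @derivative_zero_or_nonzero _ K h g (fun v => - force v) p dK p0 hx.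
  by apply/eqP; rewrite -subr_eq0; apply/eqP/h0.
(* If [h] never vanishes, [g] is constant; the equilibrium clause then gives [force (g 0) = 0], so
   [h 0 = 0], a contradiction. *)
have g10 x : g1 x = 0.
  by have /eqP := sol_ode_weak x; rewrite mulf_eq0 (negPf (hn0 x)) orbF => /eqP.
have gc x : g x = g 0.
  apply/eqP; rewrite -subr_eq0; have [x0|/ltW x0] := leP 0 x.
    by have [c _ ->] := mean_value sol_derive x0; rewrite g10 mul0r.
  by have [c _] := mean_value sol_derive x0; rewrite g10 mul0r -opprB => /eqP; rewrite oppr_eq0.
case: hg => _ _ _ /(_ _ gc).
rewrite derive1E; have [_ ->] := is_derive_potential (sol_gt0 0).
move=> /eqP; rewrite mulf_eq0 oppr_eq0 pnatr_eq0/= => /eqP F0.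
have := hn0 0; rewrite /h F0 subr0 /g2 derive1E.
have -> : derive1 g = cst 0 by apply/funext.
by rewrite derive_cst eqxx.
Qed.

End Equation.

(** * The hypersurface *)

Section Dot.
Context {R : realType} {n : nat}.
Implicit Types (x y z : 'rV[R]_n) (k : R).

Lemma dotC x y : dot x y = dot y x.
Proof. by apply: eq_bigr => i _; rewrite mulrC. Qed.

Lemma dotDl x y z : dot (x + y) z = dot x z + dot y z.
Proof. by rewrite -big_split; apply: eq_bigr => i _ /=; rewrite !mxE mulrDl. Qed.

Lemma dotZl k x y : dot (k *: x) y = k * dot x y.
Proof. by rewrite /dot mulr_sumr; apply: eq_bigr => i _; rewrite !mxE mulrA. Qed.

Lemma dotDr x y z : dot x (y + z) = dot x y + dot x z.
Proof. by rewrite dotC dotDl !(dotC x). Qed.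

Lemma dotZr k x y : dot x (k *: y) = k * dot x y.
Proof. by rewrite dotC dotZl dotC. Qed.

Lemma dot_neq0 y : dot y y = 1 -> exists i, y 0 i != 0.
Proof.
move=> yy; apply/existsP; apply: contraT; rewrite negb_exists => /forallP y0.
have : dot y y = 0 by apply: big1 => i _; have /negPn/eqP -> := y0 i; rewrite mul0r.
by rewrite yy => /eqP; rewrite oner_eq0.
Qed.

End Dot.

(** * Hyperbolic functions *)

Section Hyperbolic.
Context {R : realType}.
Implicit Types x u : R.

Lemma cosh2_sinh2 x : cosh x ^+ 2 - sinh x ^+ 2 = 1.
Proof.
have : expR x * expR (- x) = 1 by rewrite -expRD subrr expR0.
rewrite /cosh /sinh; move: (expR x) (expR (- x)) => a b ab.
have -> : ((a + b) / 2) ^+ 2 - ((a - b) / 2) ^+ 2 = a * b by field.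
exact: ab.
Qed.

Lemma coshDsinh x : cosh x + sinh x = expR x.
Proof. by rewrite /cosh /sinh; field. Qed.

Lemma coshBsinh x : cosh x - sinh x = expR (- x).
Proof. by rewrite /cosh /sinh; field. Qed.

Lemma is_derive_sinh (f : R -> R) u (a : R) : is_derive u 1 f a ->
  is_derive u 1 (fun x => sinh (f x)) (a * cosh (f u)).
Proof.
move=> df; have d1 := @is_derive1_comp _ expR f _ _ _ (is_derive_expR (f u)) df.
have d2 := @is_derive1_comp _ expR (fun x => -1 * f x) _ _ _ (is_derive_expR _)
  (is_derive_scale (-1) df).
apply: (eq_is_derive _ _ (is_derive_scale 2^-1
  (is_derive_add d1 (is_derive_scale (-1) d2)))).
  by move=> x; rewrite /sinh /= mulN1r mulrC ?mulN1r ?mul1r.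
by rewrite /cosh !mulN1r; field.
Qed.

Lemma is_derive_cosh (f : R -> R) u (a : R) : is_derive u 1 f a ->
  is_derive u 1 (fun x => cosh (f x)) (a * sinh (f u)).
Proof.
move=> df; have d1 := @is_derive1_comp _ expR f _ _ _ (is_derive_expR (f u)) df.
have d2 := @is_derive1_comp _ expR (fun x => -1 * f x) _ _ _ (is_derive_expR _)
  (is_derive_scale (-1) df).
apply: (eq_is_derive _ _ (is_derive_scale 2^-1
  (is_derive_add d1 (is_derive_scale (1) d2)))).
  by move=> x; rewrite /cosh /= mulN1r mulrC ?mulN1r ?mul1r.
by rewrite /sinh !mulN1r; field.
Qed.

End Hyperbolic.

(** * A basis of the tangent spaces of the cylinder *)

Lemma fst_sum (V W : nmodType) (I : finType) (F : I -> V * W) :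
  (\sum_i F i).1 = \sum_i (F i).1.
Proof. exact: (big_morph fst (fun _ _ => erefl) erefl). Qed.

Lemma snd_sum (V W : nmodType) (I : finType) (F : I -> V * W) :
  (\sum_i F i).2 = \sum_i (F i).2.
Proof. exact: (big_morph snd (fun _ _ => erefl) erefl). Qed.

Section Basis.
Context {R : realType} {n : nat}.
Implicit Types (p X : 'rV[R]_n * R).

(** The pivot [i0] is meant to satisfy [p.1 0 i0 != 0]. Its slot carries the direction of the line;
    the other slots carry the unit vectors corrected along [i0] to be orthogonal to [p.1]. *)
Definition cyl_basis p (i0 : 'I_n) (j : 'I_n) : 'rV[R]_n * R :=
  if j == i0 then (0, 1)
  else (delta_mx 0 j - (p.1 0 j / p.1 0 i0) *: delta_mx 0 i0, 0).

Lemma cyl_basisP p i0 : p.1 0 i0 != 0 -> tangent_basis p (cyl_basis p i0).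
Proof.
move=> y0.
have sum2 (c : 'rV[R]_n) : (\sum_i c 0 i *: cyl_basis p i0 i).2 = c 0 i0.
  rewrite snd_sum (bigD1 i0)//= big1; last first.
    by move=> i /negPf ii0; rewrite /cyl_basis ii0 /= scaler0.
  by rewrite /cyl_basis eqxx addr0 /= [_ *: _]mulr1.
have sum1 (c : 'rV[R]_n) k : k != i0 ->
    (\sum_i c 0 i *: cyl_basis p i0 i).1 0 k = c 0 k.
  move=> ki0; rewrite fst_sum summxE (bigD1 k)//=.
  rewrite big1 => [|i ik]; rewrite /cyl_basis.
    by rewrite (negPf ki0) !mxE !eqxx (negPf ki0) mulr0 subr0 mulr1 addr0.
  case: ifP => [_|_]; rewrite !mxE ?mulr0//= eq_sym (negPf ik) (negPf ki0).
  by rewrite mulr0 subr0 mulr0.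
have dot_delta y j : dot y (delta_mx 0 j) = y 0 j.
  rewrite /dot (bigD1 j)//= big1 => [|i ij]; rewrite mxE ?eqxx ?mulr1 ?addr0//.
  by rewrite (negPf ij) mulr0.
have tan i : tangent p (cyl_basis p i0 i).
  rewrite /tangent /cyl_basis; case: ifP => _ /=.
    by rewrite -(scale0r 0) dotZr mul0r.
  by rewrite -scaleN1r dotDr !dotZr !dot_delta divfK// mulN1r subrr.
split=> // X tX; exists (\row_i (if i == i0 then X.2 else X.1 0 i)); split.
  set c := \row__ _; set Y := \sum_i _.
  have Y2 : Y.2 = X.2 by rewrite sum2 mxE eqxx.
  have Y1 k : k != i0 -> Y.1 0 k = X.1 0 k.
    by move=> ki0; rewrite sum1// mxE (negPf ki0).
  have tY : dot p.1 Y.1 = 0.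
    rewrite fst_sum /dot.
    under eq_bigr do rewrite summxE mulr_sumr.
    rewrite exchange_big big1// => i _ /=; have := tan i; rewrite /tangent => ti.
    have := dotZr (c 0 i) p.1 (cyl_basis p i0 i).1; rewrite ti mulr0; exact.
  (* [X.1] and [Y.1] agree off [i0] and are both orthogonal to [p.1], which forces the remaining
     entry. *)
  have : p.1 0 i0 * (X.1 0 i0 - Y.1 0 i0) = dot p.1 (X.1 + (-1) *: Y.1).
    rewrite /dot (bigD1 i0)//= big1 => [|k ki0]; rewrite !mxE mulN1r ?addr0//.
    by rewrite Y1// subrr mulr0.
  rewrite dotDr dotZr tX tY mulr0 addr0 => /eqP.
  rewrite mulf_eq0 (negPf y0) subr_eq0 => /= /eqP X0.
  apply: injective_projections; last by rewrite Y2.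
  by apply/rowP => k; have [->//|/Y1->] := eqVneq k i0.
move=> c XE; apply/rowP => i; rewrite mxE; case: eqVneq => [->|ii0].
  by rewrite XE sum2.
by rewrite XE sum1.
Qed.

End Basis.

(** * Function algebras closed under differentiation *)

Section Polynomials.
Context {R : realType} (G : (R -> R) -> Prop).
Implicit Types (f g : R -> R) (c : R).

Inductive polynomial_in : (R -> R) -> Prop :=
| Poly_gen f : G f -> polynomial_in f
| Poly_cst c : polynomial_in (fun=> c)
| Poly_add f g : polynomial_in f -> polynomial_in g -> polynomial_in (fun u => f u + g u)
| Poly_mul f g : polynomial_in f -> polynomial_in g -> polynomial_in (fun u => f u * g u).

Lemma eq_polynomial_in f g : f =1 g -> polynomial_in f -> polynomial_in g.
Proof. by move=> /funext->. Qed.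

Lemma Poly_opp f : polynomial_in f -> polynomial_in (fun u => - f u).
Proof.
move=> Gf; apply: (@eq_polynomial_in (fun u => -1 * f u)) => [u|].
  by rewrite mulN1r.
exact: Poly_mul (Poly_cst _) Gf.
Qed.

Lemma polynomial_in_derive :
  (forall f, G f -> exists2 f', polynomial_in f' & forall u : R, is_derive u 1 f (f' u)) ->
  forall f, polynomial_in f ->
    exists2 f', polynomial_in f' & forall u : R, is_derive u 1 f (f' u).
Proof.
move=> dG f; elim=> {f} [f /dG//|c|f g pf [f' pf' df] pg [g' pg' dg]|f g pf [f' pf' df] pg [g' pg' dg]].
- by exists (fun=> 0); [exact: Poly_cst | move=> u; exact: is_derive_cst].
- exists (fun u => f' u + g' u); first exact: Poly_add.
  by move=> u; exact: is_derive_add.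
- exists (fun u => f' u * g u + f u * g' u).
    by apply: Poly_add; exact: Poly_mul.
  by move=> u; exact: is_derive_mul.
Qed.

End Polynomials.

(** * Orthogonal matrices *)

Section Orthogonal.
Context {R : realType} {n : nat}.
Implicit Types (A : 'M[R]_n) (x y : 'rV[R]_n).

Lemma dotE x y : dot x y = (x *m y^T) 0 0.
Proof. by rewrite mxE; apply: eq_bigr => i _; rewrite mxE. Qed.

Lemma orthogonal_trmx A : orthogonal_mx A -> orthogonal_mx A^T.
Proof. by rewrite /orthogonal_mx trmxK => /mulmx1C. Qed.

Lemma dot_orthogonal A x y : orthogonal_mx A -> dot (x *m A^T) (y *m A^T) = dot x y.
Proof.
move=> /mulmx1C AA; rewrite !dotE trmx_mul trmxK mulmxA -[x *m _ *m _]mulmxA AA.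
by rewrite mulmx1.
Qed.

End Orthogonal.

(** * Embedding, curvature and isometries of the rotational hypersurface *)

Section Hypersurface.
Context {R : realType} {n : nat} (H : R) (r r1 lam mu th : R -> R).
(** These relations are all that the geometry uses of [g]. Given [dth], [energy] says that the
    profile curve has unit speed; [drl] is the Codazzi equation, and [mean] fixes the trace of the
    shape operator. *)
Hypotheses (n0 : (0 < n)%N) (r_gt0 : forall u, 0 < r u) (lam_gt0 : forall u, 0 < lam u).
Hypothesis dr : forall u : R, is_derive u 1 r (r1 u).
Hypothesis dr1 : forall u : R, is_derive u 1 r1 (r u - mu u * (r u * lam u)).
Hypothesis drl : forall u : R, is_derive u 1 (fun x => r x * lam x) (mu u * r1 u).
Hypothesis dth : forall u : R, is_derive u 1 th (r u * lam u / (1 + r u ^+ 2)).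
Hypothesis energy : forall u, r1 u ^+ 2 + (r u * lam u) ^+ 2 = 1 + r u ^+ 2.
Hypothesis mean : forall u, (n%:R - 1) * lam u + mu u = n%:R * H.
Implicit Types (u : R) (p X Y : 'rV[R]_n * R).

Let a u : R := Num.sqrt (1 + r u ^+ 2).
Let w u : R := (a u)^-1.
Let L u : R := r u * lam u.
Let sh u : R := sinh (th u).
Let ch u : R := cosh (th u).

Definition phi_b u : R := a u * sh u.
Definition phi_c u : R := a u * ch u.
Definition phi_b' u : R := r u * r1 u * w u * sh u + L u * w u * ch u.
Definition phi_c' u : R := r u * r1 u * w u * ch u + L u * w u * sh u.
Definition nu_a u : R := - L u.
Definition nu_b u : R := - (r u * L u * w u) * sh u + r1 u * w u * ch u.
Definition nu_c u : R := - (r u * L u * w u) * ch u + r1 u * w u * sh u.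

Definition profile : 'rV[R]_n * R -> 'rV[R]_(n + 1 + 1) := rot r phi_b phi_c.
Definition normal : 'rV[R]_n * R -> 'rV[R]_(n + 1 + 1) := rot nu_a nu_b nu_c.

Lemma r2_gt0 u : 0 < 1 + r u ^+ 2.
Proof. by rewrite ltr_pwDl// sqr_ge0. Qed.

Lemma a_gt0 u : 0 < a u.
Proof. by rewrite sqrtr_gt0 r2_gt0. Qed.

Lemma a_sqr u : a u ^+ 2 = 1 + r u ^+ 2.
Proof. by rewrite sqr_sqrtr// ltW// r2_gt0. Qed.

Lemma aw u : a u * w u = 1.
Proof. by rewrite mulfV// lt0r_neq0// a_gt0. Qed.

Lemma w_sqr u : w u ^+ 2 * (1 + r u ^+ 2) = 1.
Proof. by rewrite -a_sqr -exprMn mulrC aw expr1n. Qed.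

Lemma chsh u : ch u ^+ 2 - sh u ^+ 2 = 1.
Proof. exact: cosh2_sinh2. Qed.

Lemma is_derive_a u : is_derive u 1 a (r u * r1 u * w u).
Proof.
have d2 := is_derive_add (is_derive_cst (1 : R) u 1) (is_derive_exp 2 (dr u)).
apply: (eq_is_derive _ _ (@is_derive1_comp _ Num.sqrt (fun x => 1 + r x ^+ 2) _ _ _
  (is_derive1_sqrt (r2_gt0 u)) d2)) => //.
by rewrite /= expr1 add0r /w /a invfM; field; exact: lt0r_neq0 (a_gt0 u).
Qed.

Lemma is_derive_th u : is_derive u 1 th (L u * w u ^+ 2).
Proof. by have := dth u; rewrite -a_sqr exprVn. Qed.

Lemma is_derive_w u : is_derive u 1 w (- (r u * r1 u * w u ^+ 3)).
Proof.
apply: (eq_is_derive _ _ (is_derive_inv (lt0r_neq0 (a_gt0 u)) (is_derive_a u))) => //.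
by rewrite -/(w u); ring.
Qed.

Lemma is_derive_phi_b u : is_derive u 1 phi_b (phi_b' u).
Proof.
apply: (eq_is_derive _ _ (is_derive_mul (is_derive_a u) (is_derive_sinh (is_derive_th u)))) => //.
rewrite /phi_b' -/(sh u) -/(ch u).
have -> : a u * (L u * w u ^+ 2 * ch u) = (a u * w u) * (L u * w u * ch u) by ring.
by rewrite aw mul1r.
Qed.

Lemma is_derive_phi_c u : is_derive u 1 phi_c (phi_c' u).
Proof.
apply: (eq_is_derive _ _ (is_derive_mul (is_derive_a u) (is_derive_cosh (is_derive_th u)))) => //.
rewrite /phi_c' -/(sh u) -/(ch u).
have -> : a u * (L u * w u ^+ 2 * sh u) = (a u * w u) * (L u * w u * sh u) by ring.
by rewrite aw mul1r.
Qed.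

Lemma is_derive_nu_a u : is_derive u 1 nu_a (- mu u * r1 u).
Proof.
apply: (eq_is_derive _ _ (is_derive_scale (-1) (drl u))) => [x|]; first by rewrite mulN1r.
by ring.
Qed.

Lemma is_derive_nu_b u : is_derive u 1 nu_b (- mu u * phi_b' u).
Proof.
have d1 := is_derive_mul (is_derive_mul (dr u) (drl u)) (is_derive_w u).
have d2 := is_derive_mul (is_derive_scale (-1) d1) (is_derive_sinh (is_derive_th u)).
have d3 := is_derive_mul (is_derive_mul (dr1 u) (is_derive_w u)) (is_derive_cosh (is_derive_th u)).
apply: (eq_is_derive _ _ (is_derive_add d2 d3)).
  by move=> x; rewrite /nu_b mulN1r.
rewrite /= -/(sh u) -/(ch u) -/(L u) /phi_b'.
move: (w_sqr u) (energy u); rewrite -/(L u).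
move: (r u) (r1 u) (L u) (w u) (sh u) (ch u) (mu u) => x x1 l v s c k wE eE.
apply/eqP; rewrite -subr_eq0; apply/eqP.
(* The difference of the two sides lies in the ideal generated by the relations [w_sqr] and
   [energy]; the cofactors are displayed. *)
transitivity ((s * x1 * l * v - c * x * v) * (v ^+ 2 * (1 + x ^+ 2) - 1)
   - c * x * v ^+ 3 * (x1 ^+ 2 + l ^+ 2 - (1 + x ^+ 2))).
  ring.
by rewrite wE eE !subrr !mulr0 subrr.
Qed.

Lemma is_derive_nu_c u : is_derive u 1 nu_c (- mu u * phi_c' u).
Proof.
have d1 := is_derive_mul (is_derive_mul (dr u) (drl u)) (is_derive_w u).
have d2 := is_derive_mul (is_derive_scale (-1) d1) (is_derive_cosh (is_derive_th u)).
have d3 := is_derive_mul (is_derive_mul (dr1 u) (is_derive_w u)) (is_derive_sinh (is_derive_th u)).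
apply: (eq_is_derive _ _ (is_derive_add d2 d3)).
  by move=> x; rewrite /nu_c mulN1r.
rewrite /= -/(sh u) -/(ch u) -/(L u) /phi_c'.
move: (w_sqr u) (energy u); rewrite -/(L u).
move: (r u) (r1 u) (L u) (w u) (sh u) (ch u) (mu u) => x x1 l v s c k wE eE.
apply/eqP; rewrite -subr_eq0; apply/eqP.
transitivity ((c * x1 * l * v - s * x * v) * (v ^+ 2 * (1 + x ^+ 2) - 1)
   - s * x * v ^+ 3 * (x1 ^+ 2 + l ^+ 2 - (1 + x ^+ 2))).
  ring.
by rewrite wE eE !subrr !mulr0 subrr.
Qed.

Lemma is_derive_profile p X :
  is_derive p X profile
    (vec (X.2 * r1 p.2 *: p.1 + r p.2 *: X.1) (X.2 * phi_b' p.2) (X.2 * phi_c' p.2)).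
Proof. exact: is_derive_rot (dr _) (is_derive_phi_b _) (is_derive_phi_c _). Qed.

Lemma is_derive_normal p X : is_derive p X normal
  (vec (X.2 * (- mu p.2 * r1 p.2) *: p.1 + nu_a p.2 *: X.1)
       (X.2 * (- mu p.2 * phi_b' p.2)) (X.2 * (- mu p.2 * phi_c' p.2))).
Proof.
exact: is_derive_rot (is_derive_nu_a _) (is_derive_nu_b _) (is_derive_nu_c _).
Qed.

Lemma profile_hyperboloid p : cylinder p -> hyperboloid (profile p).
Proof.
rewrite /cylinder /hyperboloid /= => p1.
rewrite minkowski_vec dotZl dotZr p1 /phi_b /phi_c.
move: (a_sqr p.2) (chsh p.2).
move: (r p.2) (a p.2) (sh p.2) (ch p.2) => x y s c aE cE.
transitivity (x ^+ 2 - y ^+ 2 * (c ^+ 2 - s ^+ 2)); first by ring.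
by rewrite cE aE; ring.
Qed.

(** By unit speed the metric is a warped product, in which only [r] occurs; this is why a period of
    [r] yields isometries. *)
Lemma profile_metric p X Y : cylinder p -> tangent p X -> tangent p Y ->
  Defs.minkowski ('D_X profile p) ('D_Y profile p) =
  r p.2 ^+ 2 * dot X.1 Y.1 + X.2 * Y.2.
Proof.
rewrite /cylinder /tangent /= => p1 pX pY.
have [_ ->] := is_derive_profile p X; have [_ ->] := is_derive_profile p Y.
rewrite minkowski_vec !(dotDl, dotDr, dotZl, dotZr) (dotC X.1 p.1) p1 pX pY.
rewrite /phi_b' /phi_c' !mulr0 !add0r !addr0.
move: (w_sqr p.2) (energy p.2) (chsh p.2); rewrite -/(L _).
move: (r p.2) (r1 p.2) (L p.2) (w p.2) (sh p.2) (ch p.2) (dot _ _) (X.2) (Y.2).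
move=> x x1 l v s c d X2 Y2 wE eE cE.
apply/eqP; rewrite -subr_eq0; apply/eqP.
transitivity (X2 * Y2 * ((l ^+ 2 - x ^+ 2 * x1 ^+ 2) * v ^+ 2 * ((c ^+ 2 - s ^+ 2) - 1)
  + v ^+ 2 * (x1 ^+ 2 + l ^+ 2 - (1 + x ^+ 2))
  + (1 - x1 ^+ 2) * (v ^+ 2 * (1 + x ^+ 2) - 1))); first by ring.
by rewrite wE eE cE !subrr !mulr0 !addr0 mulr0.
Qed.

Lemma normalP p : cylinder p ->
  [/\ Defs.minkowski (normal p) (profile p) = 0,
      forall X, tangent p X -> Defs.minkowski (normal p) ('D_X profile p) = 0
    & Defs.minkowski (normal p) (normal p) = 1].
Proof.
rewrite /cylinder /tangent /= => p1.
move: (w_sqr p.2) (energy p.2) (chsh p.2) (aw p.2); rewrite -/(L _) => wE eE cE aE.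
split.
- rewrite minkowski_vec !(dotZl, dotZr) p1 /nu_a /nu_b /nu_c /phi_b /phi_c.
  move: aE cE; move: (r p.2) (r1 p.2) (L p.2) (w p.2) (sh p.2) (ch p.2) (a p.2).
  move=> x x1 l v s c y aE cE.
  transitivity (x * l * ((y * v) * (c ^+ 2 - s ^+ 2) - 1)); first by ring.
  by rewrite aE cE mul1r subrr mulr0.
- move=> X pX; have [_ ->] := is_derive_profile p X.
  rewrite minkowski_vec !(dotDr, dotZl, dotZr) p1 pX /nu_a /nu_b /nu_c /phi_b' /phi_c'.
  move: wE cE; move: (r p.2) (r1 p.2) (L p.2) (w p.2) (sh p.2) (ch p.2) (X.2).
  move=> x x1 l v s c X2 wE cE.
  transitivity (X2 * l * x1 * ((v ^+ 2 * (1 + x ^+ 2)) * (c ^+ 2 - s ^+ 2) - 1)); first by ring.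
  by rewrite wE cE mul1r subrr mulr0.
- rewrite minkowski_vec !(dotZl, dotZr) p1 /nu_a /nu_b /nu_c.
  move: wE eE cE; move: (r p.2) (r1 p.2) (L p.2) (w p.2) (sh p.2) (ch p.2).
  move=> x x1 l v s c wE eE cE.
  apply/eqP; rewrite -subr_eq0; apply/eqP.
  transitivity ((x1 ^+ 2 - x ^+ 2 * l ^+ 2) * v ^+ 2 * ((c ^+ 2 - s ^+ 2) - 1)
    + v ^+ 2 * (x1 ^+ 2 + l ^+ 2 - (1 + x ^+ 2))
    + (1 - l ^+ 2) * (v ^+ 2 * (1 + x ^+ 2) - 1)); first by ring.
  by rewrite wE eE cE !subrr !mulr0 !addr0.
Qed.

Lemma profile_immersion p X : cylinder p -> tangent p X -> 'D_X profile p = 0 -> X = 0.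
Proof.
move=> cp tX; have [_ ->] := is_derive_profile p X.
have -> : 0 = vec (0 : 'rV[R]_n) 0 0.
  by rewrite -[LHS](scale0r (vec (0 : 'rV[R]_n) 0 0)) -vecZ scaler0 !mulr0.
move=> /vec_inj[e1 e2 e3].
have X2 : X.2 = 0.
  (* Pairing with [(ch, - sh)] eliminates the radial part and leaves [X.2] times the positive factor
     [L w]. *)
  have : X.2 * (L p.2 * w p.2) * (ch p.2 ^+ 2 - sh p.2 ^+ 2) =
      (X.2 * phi_b' p.2) * ch p.2 - (X.2 * phi_c' p.2) * sh p.2.
    by rewrite /phi_b' /phi_c'; ring.
  rewrite e2 e3 chsh !mul0r subrr mulr1 => /eqP; rewrite mulf_eq0 => /orP[/eqP//|].
  by rewrite gt_eqF// mulr_gt0 ?invr_gt0 ?a_gt0// /L mulr_gt0.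
move: e1; rewrite X2 mul0r scale0r add0r => /eqP; rewrite scaler_eq0 gt_eqF//= => /eqP X1.
by apply: injective_projections.
Qed.

(** [cyl_basis] diagonalizes the shape operator: [mu] along the profile curve, in slot [i0], and
    [lam] on the [n - 1] sphere directions. *)
Lemma profile_mean_curvature p : cylinder p -> mean_curvature_at profile normal p H.
Proof.
move=> cp; have [i0 y0] := dot_neq0 cp.
exists (fun i => if i == i0 then mu p.2 else lam p.2); split; last first.
  rewrite (bigD1 i0)//= eqxx (eq_bigr (fun=> lam p.2)) => [|i /negPf->//].
  rewrite sumr_const cardC1 card_ord -[_ *+ _]mulr_natr.
  have nE : n.-1%:R = n%:R - 1 :> R by rewrite -subn1 natrB.
  by rewrite nE addrC [lam _ * _]mulrC mean mulrC mulKf// pnatr_eq0 -lt0n.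
exists (fun X => (lam p.2 *: X.1, mu p.2 * X.2)), (cyl_basis p i0); split.
- move=> X tX; split; first by rewrite /tangent /= dotZr tX mulr0.
  set AX := (_, _).
  have D : 'D_AX profile p = - 'D_X normal p.
    have [_ ->] := is_derive_profile p AX; have [_ ->] := is_derive_normal p X.
    rewrite -scaleN1r -vecZ /AX /=; congr vec; last 2 first.
    - by ring.
    - by ring.
    rewrite scalerDr !scalerA; congr (_ *: _ + _ *: _); rewrite /nu_a /L; ring.
  have tAX : tangent p AX by rewrite /tangent /AX /= dotZr tX mulr0.
  rewrite /hyp_derive D.
  (* The projection term vanishes: the derivative of the normal is already tangent to the
     hypersurface, hence to the hyperboloid. *)
  have -> : Defs.minkowski ('D_X normal p) (profile p) = 0.
    have -> : 'D_X normal p = -1 *: 'D_AX profile p by rewrite D scaleN1r opprK.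
    have [_ ->] := is_derive_profile p AX.
    rewrite -vecZ minkowski_vec !(dotZl, dotDl, dotZr) /AX /=.
    rewrite (dotC X.1) tX.
    move: (a_sqr p.2); have := aw p.2; have := chsh p.2; have := w_sqr p.2.
    move: (cp); rewrite /cylinder /= => ->.
    rewrite /phi_b /phi_c /phi_b' /phi_c'.
    move: (r p.2) (r1 p.2) (L p.2) (w p.2) (sh p.2) (ch p.2) (a p.2) (X.2) (mu p.2).
    move=> x x1 l v s c y X2 m wE cE aE yE.
    transitivity (m * X2 * x * x1 * ((y * v) * (c ^+ 2 - s ^+ 2) - 1)); first by ring.
    by rewrite aE cE mul1r subrr mulr0.
  by rewrite scale0r addr0.
- exact: cyl_basisP.
- move=> i; rewrite /cyl_basis; case: eqVneq => _ /=; apply: injective_projections => //=.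
    by rewrite !scaler0.
  by rewrite mulr0; exact/esym/mulr0.
Qed.

Lemma th_lt u v : u < v -> th u < th v.
Proof.
move=> uv; have [c _] := mean_value dth (ltW uv).
rewrite -subr_gt0 => ->; rewrite mulr_gt0 ?subr_gt0// divr_gt0 ?r2_gt0//.
by rewrite mulr_gt0.
Qed.

Lemma th_inj : injective th.
Proof.
move=> u v uv; have [/th_lt|/th_lt|//] := ltgtP u v; by rewrite uv ltxx.
Qed.

(** This is [exp (2 th u)], kept as the quotient of [cosh + sinh] by [cosh - sinh]. *)
Let q u : R := expR (th u) / expR (- th u).

Lemma q_inj : injective q.
Proof.
move=> u v; rewrite /q -!expRB !opprK => /expR_inj e; apply: th_inj; lra.
Qed.

Lemma q_continuous : continuous q.
Proof.
move=> u; have d1 := @is_derive1_comp _ expR th _ _ _ (is_derive_expR (th u)) (dth u).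
have d2 := @is_derive1_comp _ expR (fun x => -1 * th x) _ _ _ (is_derive_expR _)
  (is_derive_scale (-1) (dth u)).
have d3 := is_derive_mul d1 (@is_derive_inv _ (expR \o (fun x => -1 * th x)) _ _
  (lt0r_neq0 (expR_gt0 _)) d2).
apply: (@is_derive_continuous _ _ _ _ (eq_is_derive _ erefl d3)) => x.
by rewrite /q /= mulN1r.
Qed.

(* With [(b, c)] the last two coordinates of [profile (y, u)], [(c + b) / (c - b)]
   is [exp (2 th u)], which determines [u]. *)
Definition slope (x : 'rV[R]_(n + 1 + 1)) : R :=
  (x 0 (rshift (n + 1) 0) + x 0 (lshift 1 (rshift n 0))) /
  (x 0 (rshift (n + 1) 0) - x 0 (lshift 1 (rshift n 0))).

(** Outside the range of [q] the value is the default 0; on the image of [profile] the slope always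
    lies in that range. *)
Definition q_inv (t : R) : R := xget 0 [set u | q u = t].

Definition profile_inv (x : 'rV[R]_(n + 1 + 1)) : 'rV[R]_n * R :=
  ((r (q_inv (slope x)))^-1 *: lsubmx (lsubmx x), q_inv (slope x)).

Lemma qK : cancel q q_inv.
Proof. by move=> u; rewrite /q_inv; apply: xget_unique => // v /q_inj. Qed.

Lemma profile_coord p :
  profile p 0 (rshift (n + 1) 0) = phi_c p.2 /\
  profile p 0 (lshift 1 (rshift n 0)) = phi_b p.2.
Proof. by rewrite /profile /rot /vec row_mxEr row_mxEl row_mxEr !mxE. Qed.

Lemma slope_profile p : slope (profile p) = q p.2.
Proof.
rewrite /slope; have [-> ->] := profile_coord p.
rewrite /phi_c /phi_b -mulrDr -mulrBr coshDsinh coshBsinh.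
by rewrite invfM mulrACA divff ?mul1r// lt0r_neq0// a_gt0.
Qed.

Lemma profileK p : profile_inv (profile p) = p.
Proof.
rewrite /profile_inv slope_profile qK /profile /rot /vec !row_mxKl scalerA mulVf ?scale1r.
  by case: p.
exact: lt0r_neq0.
Qed.

Lemma profile_inv_continuous p : {for profile p, continuous profile_inv}.
Proof.
have cratio (V : normedModType R) (f g : V -> R) x : {for x, continuous f} ->
    {for x, continuous g} -> f x - g x != 0 ->
    {for x, continuous (fun x => (f x + g x) / (f x - g x))}.
  move=> cf cg fg; apply: cvgM; first exact: cvgD.
  by apply: cvgV => //; exact: cvgB.
have cpair (V W : normedModType R) (f : V -> W) (h : V -> R) x :
    {for x, continuous f} -> {for x, continuous h} ->
    {for x, continuous (fun x => ((r (h x))^-1 *: f x, h x))}.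
  move=> cf cvh.
  have cvr : {for x, continuous (fun x => (r (h x))^-1 *: f x)}.
    apply: cvgZ => //; apply: cvgV; first exact: lt0r_neq0.
    by apply: (cvg_comp _ r cvh); exact: is_derive_continuous (dr _).
  exact: (cvg_pair cvr cvh).
have cs : {for profile p, continuous slope}.
  apply: (@cratio 'rV[R]_(n + 1 + 1)); do 2?exact: coord_continuous.
  have [-> ->] := profile_coord p.
  by rewrite /phi_c /phi_b -mulrBr coshBsinh mulf_neq0// lt0r_neq0 ?a_gt0 ?expR_gt0.
(* A left inverse of a continuous injective function of one real variable is continuous at the
   values of that function. *)
have cq : {for slope (profile p), continuous q_inv}.
  rewrite slope_profile.
  apply: nbhs_singleton (near_can_continuous _ _); near=> u; [exact: qK | exact: q_continuous].
apply: (@cpair 'rV[R]_(n + 1 + 1) 'rV[R]_n); last exact: continuous_comp cs cq.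
have -> : (fun x : 'rV[R]_(n + 1 + 1) => lsubmx (lsubmx x)) =
    fun x => x *m lsubmx (lsubmx 1%:M).
  by apply/funext => x; rewrite !mulmx_lsub mulmx1.
exact: mulmxr_continuous.
Unshelve. all: by end_near. Qed.

Let r_inv u : R := (r u)^-1.

(* The coefficients of [profile] and [normal] are polynomials in these functions,
   whose derivatives are again polynomials in them. *)
Let gens (f : R -> R) : Prop :=
  f = r \/ f = r1 \/ f = r_inv \/ f = lam \/ f = a \/ f = w \/ f = sh \/ f = ch.

Let S := polynomial_in gens.

Let S_r : S r. Proof. by apply: Poly_gen; left. Qed.
Let S_r1 : S r1. Proof. by apply: Poly_gen; do 1!right; left. Qed.
Let S_r_inv : S r_inv. Proof. by apply: Poly_gen; do 2!right; left. Qed.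
Let S_lam : S lam. Proof. by apply: Poly_gen; do 3!right; left. Qed.
Let S_a : S a. Proof. by apply: Poly_gen; do 4!right; left. Qed.
Let S_w : S w. Proof. by apply: Poly_gen; do 5!right; left. Qed.
Let S_sh : S sh. Proof. by apply: Poly_gen; do 6!right; left. Qed.
Let S_ch : S ch. Proof. by apply: Poly_gen; do 7!right. Qed.

(** The relation [mean] makes [mu] an affine function of [lam]. *)
Let S_mu : S mu.
Proof.
apply: (@eq_polynomial_in _ _ (fun u => n%:R * H + - (n%:R - 1) * lam u)) => [u|].
  by rewrite -(mean u); ring.
by apply: Poly_add; [exact: Poly_cst | apply: Poly_mul => //; exact: Poly_cst].
Qed.

Let S_L : S L. Proof. exact: Poly_mul. Qed.

Let S_derive f : S f -> exists2 f', S f' & forall u : R, is_derive u 1 f (f' u).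
Proof.
apply: polynomial_in_derive => {}f.
have S_th : S (fun u => L u * (w u * w u)) by do 2?apply: Poly_mul.
have d_inv u : is_derive u 1 r_inv (- (r1 u * (r_inv u * r_inv u))).
  by apply: (eq_is_derive _ _ (is_derive_inv (lt0r_neq0 (r_gt0 u)) (dr u))) => //; rewrite mulNr.
move=> [->|[->|[->|[->|[->|[->|[->|->]]]]]]].
- by exists r1.
- exists (fun u => r u + - (mu u * L u)) => //.
  by apply: Poly_add => //; apply: Poly_opp; exact: Poly_mul.
- exists (fun u => - (r1 u * (r_inv u * r_inv u))) => //.
  by apply: Poly_opp; do 2?apply: Poly_mul.
(* [lam] is differentiated as the product of [r lam] and [1 / r]. *)
- exists (fun u => (mu u * r1 u) * r_inv u + L u * - (r1 u * (r_inv u * r_inv u))).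
    by apply: Poly_add; apply: Poly_mul => //; [exact: Poly_mul |
      apply: Poly_opp; do 2?apply: Poly_mul].
  move=> u; apply: (eq_is_derive _ _ (is_derive_mul (drl u) (d_inv u))) => // x.
  by rewrite /r_inv mulrAC divff ?mul1r// lt0r_neq0.
- exists (fun u => (r u * r1 u) * w u); last exact: is_derive_a.
  by do 2?apply: Poly_mul.
- exists (fun u => - ((r u * r1 u) * (w u * (w u * w u)))).
    by apply: Poly_opp; do 4?apply: Poly_mul.
  by move=> u; have := is_derive_w u; congr is_derive; ring.
- exists (fun u => L u * (w u * w u) * ch u); first exact: Poly_mul.
  by move=> u; exact: is_derive_sinh (is_derive_th u).
- exists (fun u => L u * (w u * w u) * sh u); first exact: Poly_mul.
  by move=> u; exact: is_derive_cosh (is_derive_th u).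
Qed.

Lemma smooth_profile : smooth profile.
Proof.
by move=> k; apply: (Ck_rot S_derive) => //; exact: Poly_mul.
Qed.

Lemma smooth_normal : smooth normal.
Proof.
move=> k; apply: (Ck_rot S_derive); first exact: Poly_opp.
- by apply: Poly_add; apply: Poly_mul => //; [apply: Poly_opp; do 2?apply: Poly_mul | exact: Poly_mul].
- by apply: Poly_add; apply: Poly_mul => //; [apply: Poly_opp; do 2?apply: Poly_mul | exact: Poly_mul].
Qed.

Lemma profile_embedded : embedded_hypersurface profile.
Proof.
split; first exact: smooth_profile.
- by move=> _ [p cp <-]; exact: profile_hyperboloid.
- by move=> p X; exact: profile_immersion.
- exists profile_inv; split; first by move=> p _; exact: profileK.
  apply: continuous_in_subspaceT => x; rewrite inE => -[p _ <-].
  exact: profile_inv_continuous.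
Qed.

Lemma profile_constant_mean_curvature : has_constant_mean_curvature profile H.
Proof.
exists normal; split; last exact: profile_mean_curvature.
by split; [exact: smooth_normal | move=> p; exact: normalP].
Qed.

Variable T : R.
Hypotheses (T_neq0 : T != 0) (r_periodic : forall u, r (u + T) = r u).

Lemma r_periodic_int u (k : int) : r (u + k%:~R * T) = r u.
Proof.
have rn (m : nat) v : r (v + m%:R * T) = r v.
  elim: m => [|m IH]; first by rewrite mul0r addr0.
  by rewrite -natr1 mulrDl mul1r addrA r_periodic IH.
case: k => m; first exact: rn.
by rewrite NegzE mulrNz mulNr -(rn m.+1 (u - _)) subrK.
Qed.

(** On row vectors [A] acts by right multiplication with its transpose, so that matrix products
    become compositions in the same order. *)
Definition screw (A : 'M[R]_n) (k : int) p : 'rV[R]_n * R :=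
  (p.1 *m A^T, p.2 + k%:~R * T).

Lemma smooth_screw A k : smooth (screw A k).
Proof.
apply: (@smooth_affine _ _ _ _ (fun X => (X.1 *m A^T, X.2))).
  move=> p.
  have c1 : {for p, continuous (fun p : 'rV[R]_n * R => p.1 *m A^T)}.
    apply: (cvg_comp fst (fun y : 'rV[R]_n => y *m A^T)); first exact: cvg_fst.
    exact: mulmxr_continuous.
  have c2 : {for p, continuous (fun p : 'rV[R]_n * R => p.2 + k%:~R * T)}.
    by apply: cvgD; [exact: cvg_snd | exact: cvg_cst].
  exact: (cvg_pair c1 c2).
move=> p X h; apply: injective_projections => /=.
  by rewrite mulmxDl -scalemxAl addrC.
by rewrite -addrA addrC.
Qed.

Lemma derive_screw A k p X : 'D_X (screw A k) p = (X.1 *m A^T, X.2).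
Proof.
have [_] // : is_derive p X (screw A k) (X.1 *m A^T, X.2).
apply: is_derive_affine_map => h; apply: injective_projections => /=.
  by rewrite mulmxDl -scalemxAl addrC.
by rewrite -addrA addrC.
Qed.

Lemma screwM A B k l p : screw (A *m B) (k + l) p = screw A k (screw B l p).
Proof.
by rewrite /screw /= trmx_mul mulmxA intrD mulrDl [_ * T + _]addrC addrA.
Qed.

Lemma screw_cylinder A k p : orthogonal_mx A -> cylinder p -> cylinder (screw A k p).
Proof. by move=> oA; rewrite /cylinder /= dot_orthogonal. Qed.

Lemma screwK A k p : orthogonal_mx A -> screw A^T (- k) (screw A k p) = p.
Proof.
move=> oA; rewrite -screwM addNr (mulmx1C oA) /screw trmx1 mulmx1 mul0r addr0.
by case: p.
Qed.

Lemma screw_isometry A k : orthogonal_mx A -> Defs.isometry profile (screw A k).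
Proof.
move=> oA; split; first exact: smooth_screw.
- by move=> p; exact: screw_cylinder.
- exists (screw A^T (- k)); split; first exact: smooth_screw.
  move=> p cp; split; [|exact: screwK|].
    by apply: screw_cylinder => //; exact: orthogonal_trmx.
  by have := screwK (- k) p (orthogonal_trmx oA); rewrite trmxK opprK.
- move=> p X Y cp tX tY.
  have tF Z : tangent p Z -> tangent (screw A k p) (Z.1 *m A^T, Z.2).
    by rewrite /tangent /= dot_orthogonal.
  have eqD (f : 'rV[R]_n * R -> 'rV[R]_(n + 1 + 1)) X1 X2 Y1 Y2 p0 : X1 = X2 -> Y1 = Y2 ->
      Defs.minkowski ('D_X1 f p0) ('D_Y1 f p0) = Defs.minkowski ('D_X2 f p0) ('D_Y2 f p0).
    by move=> -> ->.
  apply: etrans (eqD _ _ _ _ _ _ (derive_screw A k p X) (derive_screw A k p Y)) _.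
  apply: etrans (profile_metric (screw_cylinder k oA cp) (tF _ tX) (tF _ tY)) _.
  by rewrite (profile_metric cp tX tY) /= dot_orthogonal// r_periodic_int.
Qed.

Lemma profile_admits_O_x_Z : admits_O_x_Z profile.
Proof.
exists screw; split; first by move=> A k; exact: screw_isometry.
  by move=> A B k l _ _ p _; exact: screwM.
move=> A B k l _ _ AB.
(* The images of the points [(e_i, 0)] give the rows of the transposed matrix and the shift [k T],
   which determines [k] as [T] is nonzero. *)
have cyl_delta i : cylinder (delta_mx 0 i : 'rV[R]_n, 0 : R).
  rewrite /cylinder /= /dot (bigD1 i)//= big1 => [|j ji].
    by rewrite !mxE !eqxx mulr1 addr0.
  by rewrite !mxE (negPf ji) mulr0.
split.
  apply: trmx_inj; apply/row_matrixP => i; rewrite !rowE.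
  by have [] := AB _ (cyl_delta i).
have [_ /=] := AB _ (cyl_delta (Ordinal n0)); rewrite !add0r => /(mulIf T_neq0).
exact: intr_inj.
Qed.

End Hypersurface.

(** * Periodicity *)

Section Periodicity.
Context {R : realType} (m : nat) (C H : R) (g : R -> R).
Hypotheses (H0 : 0 <= H) (H1 : 1 < H ^+ 2) (hg : positive_solution m.+2 C H g).
Implicit Types (u v w x y z B : R).

Lemma ler_exp_dist B k : 1 <= B -> exists2 K, 0 <= K &
  forall x y, 0 <= x <= B -> 0 <= y <= B -> `|x ^+ k - y ^+ k| <= K * `|x - y|.
Proof.
move=> B1; have B0 : 0 <= B by lra.
elim: k => [|k [K K0 IH]].
  by exists 0 => // x y _ _; rewrite !expr0 subrr normr0 mul0r.
exists (B * K + B ^+ k) => [|x y xB yB].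
  by rewrite addr_ge0 ?exprn_ge0 ?mulr_ge0.
have -> : x ^+ k.+1 - y ^+ k.+1 = x * (x ^+ k - y ^+ k) + y ^+ k * (x - y).
  by rewrite !exprS; ring.
rewrite (le_trans (ler_normD _ _))// !normrM mulrDl lerD//.
  have /andP[x0 xB'] := xB.
  by rewrite -mulrA (ger0_norm x0) ler_pM//; exact: IH.
have /andP[y0 yB'] := yB.
by rewrite ler_wpM2r// ger0_norm ?exprn_ge0// lerXn2r.
Qed.

(** Inversion is Lipschitz with constant [B^2] where inverses are at most [B], and powers are
    Lipschitz on [[0, B]]. The estimate feeds [ode2_unique]. *)
Lemma force_lipschitz B : 1 <= B -> exists2 K, 0 <= K &
  forall v w, 0 < v -> 0 < w -> v^-1 <= B -> w^-1 <= B ->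
  `|force m H v - force m H w| <= K * `|v - w|.
Proof.
move=> B1; have B0 : 0 <= B by lra.
have [K1 K10 h1] := ler_exp_dist m.+1 B1.
have [K2 K20 h2] := ler_exp_dist (2 * m + 3) B1.
exists (H ^+ 2 - 1 + (m%:R * H * K1 + m.+1%:R * K2) * (B * B)) => [|v w v0 w0 vB wB].
  by rewrite addr_ge0 ?subr_ge0 ?(ltW H1)// mulr_ge0 ?mulr_ge0// addr_ge0// !mulr_ge0.
have iv : 0 <= v^-1 <= B by rewrite invr_ge0 ltW.
have iw : 0 <= w^-1 <= B by rewrite invr_ge0 ltW.
have dV : `|v^-1 - w^-1| <= B * B * `|v - w|.
  have -> : v^-1 - w^-1 = v^-1 * w^-1 * (w - v).
    by field; rewrite !lt0r_neq0.
  rewrite !normrM distrC ler_wpM2r// ler_pM//.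
    by rewrite gtr0_norm ?invr_gt0.
  by rewrite gtr0_norm ?invr_gt0.
have -> : force m H v - force m H w = - (H ^+ 2 - 1) * (v - w)
   + (m%:R * H * (v^-1 ^+ m.+1 - w^-1 ^+ m.+1)
      + m.+1%:R * (v^-1 ^+ (2 * m + 3) - w^-1 ^+ (2 * m + 3))).
  by rewrite /force; ring.
rewrite (le_trans (ler_normD _ _))// [leRHS]mulrDl lerD//.
  have k0 : 0 <= H ^+ 2 - 1 by rewrite subr_ge0 ltW.
  by rewrite mulNr normrN normrM (ger0_norm k0).
rewrite (le_trans (ler_normD _ _))// !normrM !normr_nat (ger0_norm H0).
rewrite mulrDl [leRHS]mulrDl -!mulrA lerD// !ler_wpM2l//.
  by rewrite (le_trans (h1 _ _ iv iw))// ler_wpM2l// mulrA.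
by rewrite (le_trans (h2 _ _ iv iw))// ler_wpM2l// mulrA.
Qed.

Lemma force_nonincreasing v w : 0 < v -> v <= w -> force m H w <= force m H v.
Proof.
move=> v0 vw; have w0 : 0 < w by exact: lt_le_trans vw.
have iwv : w^-1 <= v^-1 by rewrite lef_pV2.
have iw : 0 <= w^-1 by rewrite invr_ge0 ltW.
have iv : 0 <= v^-1 by rewrite invr_ge0 ltW.
rewrite /force !lerD//.
- by rewrite !mulNr lerN2 ler_wpM2l// subr_ge0 ltW.
- by rewrite ler_wpM2l ?mulr_ge0// lerXn2r.
- by rewrite ler_wpM2l// lerXn2r.
Qed.

(** For [H >= 0] and [H^2 > 1] the three terms of the potential are nonnegative, so each is at most
    [C]. *)
Lemma sol_bounds : exists2 B, 1 <= B & forall u, `|g u| <= B /\ (g u)^-1 <= B.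
Proof.
have g0 := sol_gt0 hg.
have terms u : [/\ 0 <= (g u)^-1 ^+ (2 * m + 2), 0 <= (H ^+ 2 - 1) * g u ^+ 2,
    0 <= 2 * H * (g u)^-1 ^+ m &
    (g u)^-1 ^+ (2 * m + 2) + (H ^+ 2 - 1) * g u ^+ 2 + 2 * H * (g u)^-1 ^+ m <= C].
  have iv : 0 <= (g u)^-1 by rewrite invr_ge0 ltW.
  split; first exact: exprn_ge0.
  - by rewrite mulr_ge0 ?sqr_ge0// subr_ge0 ltW.
  - by rewrite !mulr_ge0// exprn_ge0.
  - by rewrite -(sol_energy hg u) potentialE lerDr sqr_ge0.
have C0 : 0 <= C by have [] := terms 0; lra.
have k0 : 0 < H ^+ 2 - 1 by rewrite subr_gt0.
(* [C / (H^2 - 1)] bounds [g^2], and [2 g <= g^2 + 1]; an inverse above 1 is at most its power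
   [2m + 2], hence at most [C]. *)
exists (1 + C + C / (H ^+ 2 - 1)) => [|u].
  by rewrite -addrA lerDl addr_ge0// divr_ge0// ltW.
have D0 : 0 <= C / (H ^+ 2 - 1) by rewrite divr_ge0// ltW.
have [t1 t2 t3 tC] := terms u; split.
  rewrite gtr0_norm//.
  have : g u ^+ 2 <= C / (H ^+ 2 - 1) by rewrite ler_pdivlMr// mulrC; lra.
  have := sqr_ge0 (g u - 1); rewrite sqrrB expr1n; lra.
have [x1|/ltW x1] := leP (g u)^-1 1; first lra.
have : (g u)^-1 <= (g u)^-1 ^+ (2 * m + 2).
  by rewrite -[leLHS]expr1 ler_weXn2l// addnS.
lra.
Qed.

(** The reflected function solves the same equation with the same data at [z], so [ode2_unique]
    applies to the difference. *)
Lemma sol_reflection z : derive1 g z = 0 -> forall u, g u = g (2 * z - u).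
Proof.
move=> gz u; have [B B1 hB] := sol_bounds; have [K K0 hK] := force_lipschitz B1.
have dg := sol_derive hg.
have dg1 (x : R) : is_derive x 1 (derive1 g) (force m H (g x)).
  by have := sol_derive2 hg x; rewrite (sol_ode hg).
have refl f (f' : R -> R) (x : R) : (forall y : R, is_derive y 1 f (f' y)) ->
    is_derive x 1 (fun y => f (-1 * y + 2 * z)) (- f' (-1 * x + 2 * z)).
  by move=> df; have := is_derive_affine (df (-1 * x + 2 * z)); rewrite mulrN1.
pose d x := g x - g (-1 * x + 2 * z).
pose d' x := derive1 g x + derive1 g (-1 * x + 2 * z).
have dd (x : R) : is_derive x 1 d (d' x).
  apply: (eq_is_derive _ _ (is_derive_add (dg x) (is_derive_scale (-1) (refl _ _ x dg)))).
    by move=> y; rewrite [-1 * g _]mulN1r.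
  by rewrite /d'; ring.
have dd' (x : R) : is_derive x 1 d' (force m H (g x) - force m H (g (-1 * x + 2 * z))).
  exact: is_derive_add (dg1 x) (refl _ _ x dg1).
have zz : -1 * z + 2 * z = z by ring.
have : d u = 0.
  apply: (@ode2_unique _ d d' _ K z dd dd' K0) => [x||].
  - by apply: hK; rewrite ?(sol_gt0 hg)//; exact: (hB _).2.
  - by rewrite /d zz subrr.
  - by rewrite /d' zz gz addr0.
by move=> /eqP; rewrite subr_eq0 mulN1r addrC => /eqP.
Qed.

(* [g] is symmetric about each of its critical points, and the composition of
   two such reflections is a translation. *)
Lemma sol_periodic : exists2 T : R, T != 0 & forall u, g (u + T) = g u.
Proof.
have [B _ hB] := sol_bounds.
have dg1 (x : R) : is_derive x 1 (derive1 g) (force m H (g x)).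
  by have := sol_derive2 hg x; rewrite (sol_ode hg).
have crit u0 : exists2 u, u0 <= u & derive1 g u = 0.
  apply: (@exists_critical_point _ _ _ _ B _ (sol_derive hg) dg1) => [u v uv|u].
    by apply: force_nonincreasing => //; exact: sol_gt0 hg _.
  by have [] := hB u.
have [z0 _ gz0] := crit 0.
(* Starting from [z0 + 1] makes the two critical points distinct and the period nonzero. *)
have [z1 z01 gz1] := crit (z0 + 1).
exists (2 * (z1 - z0)) => [|u].
  by rewrite mulf_neq0// gt_eqF//; lra.
rewrite (sol_reflection gz1) [RHS](sol_reflection gz0); congr g; ring.
Qed.

End Periodicity.

(** * The relations for the given solution, and the conclusion *)

Unset Implicit Arguments.

Theorem theorem7p1 (R : realType) (n : nat) (C H : R)
    (g r lambda mu theta : R -> R)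
    (phi : 'rV[R]_n * R -> 'rV[R]_(n + 1 + 1))
    (hn : (2 <= n)%N) (hH : 0 <= H) (hC : 0 < C)
    (hg : positive_solution n C H g)
    (hr : forall u, r u = g u / Num.sqrt C)
    (hlambda : forall u, lambda u = H + (g u) ^- n)
    (hmu : forall u, mu u = n%:R * H - (n%:R - 1) * lambda u)
    (htheta : forall u, theta u =
       oriented_integral (fun s => r s * lambda s / (1 + r s ^+ 2)) 0 u)
    (hphi : forall y u, phi (y, u) =
       row_mx
         (row_mx (r u *: y)
                 (const_mx (Num.sqrt (1 + r u ^+ 2) * sinh (theta u))))
         (const_mx (Num.sqrt (1 + r u ^+ 2) * cosh (theta u)))) :
  [/\ embedded_hypersurface phi,
      has_constant_mean_curvature phi H
    & 1 < H ^+ 2 -> admits_O_x_Z phi].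
Proof.
case: n phi hn hg hlambda hmu hphi => [|[|m]]// phi _ hg hlambda hmu hphi.
set n := m.+2 in phi hg hlambda hmu hphi *.
have n0 : (0 < n)%N by [].
have -> : phi = profile r theta.
  by apply/funext => -[y u]; rewrite hphi.
have g0 := sol_gt0 hg.
pose k : R := (Num.sqrt C)^-1.
have sC0 : 0 < Num.sqrt C by rewrite sqrtr_gt0.
have k0 : 0 < k by rewrite invr_gt0.
have kC : k ^+ 2 * C = 1.
  by rewrite exprVn sqr_sqrtr ?(ltW hC)// mulVf// lt0r_neq0.
have rE : r = fun u => k * g u by apply/funext => u; rewrite hr mulrC.
have lE : lambda = fun u => H + (g u)^-1 ^+ n.
  by apply/funext => u; rewrite hlambda exprVn.
have r0 u : 0 < r u by rewrite rE mulr_gt0.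
have l0 u : 0 < lambda u by rewrite lE ltr_wpDl// exprn_gt0// invr_gt0.
pose r1 u : R := k * derive1 g u.
have dr (u : R) : is_derive u 1 r (r1 u).
  by rewrite rE; exact: is_derive_scale (sol_derive hg u).
have xg u : (g u)^-1 * g u = 1 by rewrite mulVf// lt0r_neq0.
have mean u : (n%:R - 1) * lambda u + mu u = n%:R * H.
  by rewrite hmu addrC subrK.
have muE u : mu u = H - m.+1%:R * (g u)^-1 ^+ n.
  by rewrite hmu lE /n -[m.+2]addn1 natrD; ring.
have dr1 (u : R) : is_derive u 1 r1 (r u - mu u * (r u * lambda u)).
  apply: (eq_is_derive _ _ (is_derive_scale k (sol_derive2 hg u))) => //.
  (* With [x = g^(-n)] the force is [g (1 - (H - (n - 1) x) (H + x))], that is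
     [g (1 - mu lambda)]. *)
  rewrite (sol_ode hg) muE rE lE /force.
  have -> : (g u)^-1 ^+ m.+1 = (g u)^-1 ^+ n * g u.
    by rewrite [_ ^+ n]exprSr -mulrA xg mulr1.
  have -> : (g u)^-1 ^+ (2 * m + 3) = (g u)^-1 ^+ n ^+ 2 * g u.
    by rewrite -exprM (_ : n * 2 = (2 * m + 3).+1)%N ?exprSr -?mulrA ?xg ?mulr1//; lia.
  by rewrite -[m.+1]addn1 natrD; ring.
have drl (u : R) : is_derive u 1 (fun x => r x * lambda x) (mu u * r1 u).
  have dx := is_derive_exp n (is_derive_inv (lt0r_neq0 (g0 u)) (sol_derive hg u)).
  have dl := is_derive_add (is_derive_cst (H : R) u 1) dx.
  apply: (eq_is_derive _ _ (is_derive_mul (dr u) dl)) => [x|]; first by rewrite lE.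
  rewrite muE rE /r1 add0r /n /=.
  have -> : (g u)^-1 ^+ m.+2 = (g u)^-1 ^+ m.+1 * (g u)^-1 by rewrite exprSr.
  have e := xg u; move: e; move: (g u)^-1 => x; move: (g u) (derive1 g u) => y y1 e.
  rewrite -[m.+2]addn1 natrD.
  transitivity (k * y1 * (H + x ^+ m.+1 * x) - (m.+1%:R + 1) * x ^+ m.+1 * x * k * y1 * (x * y)).
    by ring.
  by rewrite e; ring.
have dth (u : R) : is_derive u 1 theta (r u * lambda u / (1 + r u ^+ 2)).
  have -> : theta = oriented_integral (fun s => r s * lambda s / (1 + r s ^+ 2)) 0.
    exact/funext.
  apply: is_derive_oriented_integral => x.
  have d2 := is_derive_add (is_derive_cst (1 : R) x 1) (is_derive_exp 2 (dr x)).
  have n2 : 1 + r x ^+ 2 != 0 by rewrite lt0r_neq0// ltr_pwDl// sqr_ge0.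
  exact: (@is_derive_continuous _ _ _ _ (is_derive_mul (drl x)
    (@is_derive_inv _ (fun x => 1 + r x ^+ 2) _ _ n2 d2))).
(* The potential at [g] is [g^2 (lambda^2 - 1)]; dividing the equation for [g] by [C] gives the
   claim. *)
have energy u : r1 u ^+ 2 + (r u * lambda u) ^+ 2 = 1 + r u ^+ 2.
  have := sol_energy hg u; rewrite potentialE /r1 rE lE.
  have -> : (g u)^-1 ^+ (2 * m + 2) = ((g u)^-1 ^+ n) ^+ 2 * (g u) ^+ 2.
    rewrite -exprM (_ : (n * 2)%N = (2 * m + 2 + 2)%N); last by lia.
    by rewrite [in RHS]exprD -mulrA -exprMn xg expr1n mulr1.
  have -> : (g u)^-1 ^+ m = (g u)^-1 ^+ n * (g u) ^+ 2.
    by rewrite /n -addn2 exprD -mulrA -exprMn xg expr1n mulr1.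
  move: ((g u)^-1 ^+ n) => x; move: (g u) (derive1 g u) => y y1 e.
  apply/eqP; rewrite -subr_eq0; apply/eqP.
  transitivity (k ^+ 2 * (y1 ^+ 2 + (x ^+ 2 * y ^+ 2 + (H ^+ 2 - 1) * y ^+ 2
    + 2 * H * (x * y ^+ 2))) - 1); first by ring.
  by rewrite e kC subrr.
split.
- exact: profile_embedded r0 l0 dr dr1 drl dth mean.
- exact: profile_constant_mean_curvature n0 r0 dr dr1 drl dth energy mean.
- move=> H1; have [T T0 gT] := sol_periodic hH H1 hg.
  apply: (profile_admits_O_x_Z n0 dr dth energy T0) => u.
  by rewrite rE gT.
Qed.
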